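(* Let $k$ be an odd positive integer. If $G$ is an odd-$(3k-2)$-edge-connected graph or a $(2k-2)$-tree-connected graph, then $G$ can be edge-decomposed into $k$ factors $G_1,\ldots,G_k$ such that for each $i$ and each vertex $v$, $d_{G_i}(v)\equiv d_G(v)\pmod 2$ and $$|d_{G_i}(v)-d_G(v)/k|<2.$$
   Context: Graphs are finite and may have loops and multiple edges; a loop contributes $2$ to the degree $d_G(v)$. For a vertex set $A$, $d_G(A)$ denotes the number of edges with exactly one end in $A$. A graph $G$ is odd-$\lambda$-edge-connected if $d_G(A)\ge\lambda$ for every vertex set $A$ with $d_G(A)$ odd. A graph is $m$-tree-connected if it contains $m$ edge-disjoint spanning trees. A factor is a spanning subgraph; ''edge-decomposed into factors'' means the edge set is partitioned into the edge sets of spanning subgraphs. *)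

(* Defs.v *)
From HB Require Import structures.
From mathcomp Require Import all_boot all_order all_algebra.
Set Implicit Arguments.
Unset Strict Implicit.
Unset Printing Implicit Defensive.

(* The order of the two ends carries no meaning; an edge with equal ends is a
   loop, and distinct edges may have the same ends. *)
Record mgraph := MGraph {
  vert : finType;
  edge : finType;
  ends : edge -> vert * vert
}.

(* Each end of an edge is counted, so a loop contributes 2. *)
Definition deg (G : mgraph) (v : vert G) : nat :=
  #|[set e : edge G | (ends e).1 == v]| + #|[set e : edge G | (ends e).2 == v]|.

Definition cut_size (G : mgraph) (A : {set vert G}) : nat :=
  #|[set e : edge G | ((ends e).1 \in A) (+) ((ends e).2 \in A)]|.

Definition odd_edge_connected (lambda : nat) (G : mgraph) : Prop :=
  forall A : {set vert G}, odd (cut_size A) -> lambda <= cut_size A.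

Definition factor (G : mgraph) (F : {set edge G}) : mgraph :=
  @MGraph (vert G) {e : edge G | e \in F} (fun e => ends (val e)).

Definition joins (G : mgraph) (e : edge G) (x y : vert G) : bool :=
  (ends e == (x, y)) || (ends e == (y, x)).

Definition adjacent (G : mgraph) : rel (vert G) :=
  fun x y => [exists e : edge G, joins e x y].

Definition connected_graph (G : mgraph) : Prop :=
  forall x y : vert G, connect (@adjacent G) x y.

(* The walk from x whose successive steps are the pairs (edge, next vertex). *)
Fixpoint walk (G : mgraph) (x : vert G) (p : seq (edge G * vert G)) : bool :=
  if p is (e, y) :: p' then joins e x y && walk y p' else true.

(* A loop is a cycle of length 1, two parallel edges form a cycle of
   length 2. *)
Definition is_cycle (G : mgraph) (x : vert G) (p : seq (edge G * vert G)) : bool :=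
  [&& p != [::], walk x p, last x (unzip2 p) == x,
      uniq (unzip1 p) & uniq (unzip2 p)].

Definition acyclic (G : mgraph) : Prop :=
  forall (x : vert G) (p : seq (edge G * vert G)), ~~ is_cycle x p.

Definition is_tree (G : mgraph) : Prop := connected_graph G /\ acyclic G.

Definition edge_disjoint (G : mgraph) (m : nat) (F : 'I_m -> {set edge G}) : Prop :=
  forall i j : 'I_m, i != j -> [disjoint F i & F j].

(* An indexed family rather than a set of trees: on a one-vertex graph all the
   spanning trees coincide (no edges), and are still pairwise edge-disjoint. *)
Definition tree_connected (m : nat) (G : mgraph) : Prop :=
  exists T : 'I_m -> {set edge G},
    edge_disjoint T /\ forall i : 'I_m, is_tree (factor (T i)).

(* Some of the factors may have no edges. *)
Definition edge_decomposition (G : mgraph) (m : nat) (F : 'I_m -> {set edge G}) : Prop :=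
  edge_disjoint F /\ \bigcup_(i < m) F i = [set: edge G].

(* Main.v *)
(* Suppose the edges can be oriented so that [d+(v) = d-(v)] modulo [k] at every [v].
   Split [v] into an out-copy and an in-copy and join the two copies by dummy edges
   making both degrees divisible by [k]; an equitable colouring of this bipartite
   graph gives every colour the same number of edges at each copy, hence, once the
   dummies are discarded, [d_i(v)] is [d(v)/k] rounded to one of at most two integers
   of the parity of [d(v)].

   The orientation comes from the extension theorem of Lovasz, Thomassen, Wu and
   Zhang: if every vertex set [A] avoiding a pre-oriented vertex [z0] of small degree
   satisfies [d(A) >= 2k - 2 + tau(A)], where [tau(A)] is the least possible absolute
   net degree, then the orientation extends to one with the prescribed net degrees
   modulo [2k].  For odd-edge-connected graphs, even vertices are removed by
   liftings preserving odd-edge-connectivity and a minimal set violating the cut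
   condition is contracted.  For tree-connected graphs, a violating vertex has degree
   at most [3k - 3]; liftings turn the trees into connected spanning subgraphs
   of [G - v] and leave [k - 1] edges at [v], enough to prescribe its net degree. *)
Require Import Defs.
From mathcomp Require Import all_boot all_order all_algebra.
From mathcomp Require Import zify ring lra.
Set Implicit Arguments.
Unset Strict Implicit.
Unset Printing Implicit Defensive.
Import Order.TTheory GRing.Theory Num.Theory.
Local Open Scope ring_scope.

(** * Absolute values modulo 2k *)

(** The net degree prescribed modulo [2k] is [0] or [k], according to the parity of the degree. Both
    are [0] modulo [k], and as [k] is odd they have the parity that every orientation forces; the
    number of vertices of odd degree being even, they add up to [0] modulo [2k]. Since tau is at
    most [k], a cut of [3k - 2 = (2k - 2) + k] edges always meets the cut condition: this is the
    origin of [3k - 2]. The obstacle is that the hypothesis bounds odd cuts only. A set violating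
    the condition therefore has an even cut, and its contraction is an even vertex, which liftings
    can remove. With [2k - 2] trees every cut has at least [2k - 2] edges, so a violating vertex has
    degree [2k - 2 + n] with [n <= k - 1]. Then [n] liftings leave at least [k - 1] trees with
    exactly one edge at the vertex, and these edges are free to be oriented. They suffice although
    tau can be [k], because tau has the parity of the number of free edges. A root is carried along
    because contraction cuts a problem in two: when the rest has been oriented, the contracted set
    faces edges whose directions are already fixed. *)

(* The least absolute value in the class of [b] modulo [2k]. *)
Definition dist2 (k : nat) (b : int) : int :=
  let r := (b %% (2 * k%:Z))%Z in Num.min r (2 * k%:Z - r).

Section Dist2.
Variable k : nat.
Hypothesis k_gt0 : (0 < k)%N.
Notation N := (dist2 k).

Lemma dist2_spec (b : int) : exists j s : int,
  [/\ b = 2 * k%:Z * j + s, `|s| = N b & -k%:Z < s <= k%:Z].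
Proof.
have k2 : 2 * k%:Z != 0 :> int by lia.
have E := divz_eq b (2 * k%:Z); have H0 := modz_ge0 b k2.
have H1 : (b %% (2 * k%:Z))%Z < 2 * k%:Z by rewrite ltz_mod.
rewrite /dist2; move: H0 H1 E.
set r := (b %% _)%Z; set d := (b %/ _)%Z => H0 H1 E.
have [le|gt] := lerP r k%:Z.
  by exists d, r; split; [rewrite E mulrC | rewrite /Num.min; case: ltP; lia | lia].
exists (d + 1), (r - 2 * k%:Z); split; [rewrite E mulrDr mulr1; lia | | lia].
by rewrite /Num.min; case: ltP; lia.
Qed.

Lemma dist2_min (b j : int) : N b <= `|b - 2 * k%:Z * j|.
Proof.
have [i [s [-> <- sk]]] := dist2_spec b.
have [->|ne] := eqVneq i j; first by rewrite addrAC subrr add0r.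
have -> : 2 * k%:Z * i + s - 2 * k%:Z * j = 2 * (k%:Z * (i - j)) + s by lia.
have : (k%:Z * (i - j) <= - k%:Z) || (k%:Z <= k%:Z * (i - j)).
  have /orP[h|h] : (i - j <= -1) || (1 <= i - j) by lia.
    by apply/orP; left; nia.
  by apply/orP; right; nia.
lia.
Qed.

Lemma dist2_cong (b b' : int) : (2 * k%:Z %| b - b')%Z -> N b = N b'.
Proof.
have H a a' : (2 * k%:Z %| a - a')%Z -> N a' <= N a.
  move=> /dvdzP[j Ej]; have [i [s [e <- _]]] := dist2_spec a.
  apply: le_trans (dist2_min _ (i - j)) _.
  by have -> // : a' - 2 * k%:Z * (i - j) = s; nia.
move=> D; apply/eqP; rewrite eq_le !H //.
by rewrite -opprB rpredN.
Qed.

Lemma dist2D (a b : int) : N (a + b) <= N a + N b.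
Proof.
have [i [s [ea <- _]]] := dist2_spec a; have [j [r [eb <- _]]] := dist2_spec b.
apply: le_trans (dist2_min _ (i + j)) _; apply: le_trans (ler_normD s r).
by rewrite {}ea {}eb; have -> : 2 * k%:Z * i + s + (2 * k%:Z * j + r) -
   2 * k%:Z * (i + j) = s + r by lia.
Qed.

Lemma dist2_ge0 (b : int) : 0 <= N b.
Proof. by have [i [s [_ <- _]]] := dist2_spec b. Qed.

Lemma dist2_lek (b : int) : N b <= k%:Z.
Proof. have [i [s [_ <- sk]]] := dist2_spec b; lia. Qed.

Lemma dist2_le_norm (b : int) : N b <= `|b|.
Proof. by have := dist2_min b 0; rewrite mulr0 subr0. Qed.

Lemma dist2_par (b : int) : (2 %| N b - b)%Z.
Proof.
have [i [s [-> <- _]]] := dist2_spec b; apply/dvdzP.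
by case: (lerP 0 s) => h; [exists (- (k%:Z * i)) | exists (- (k%:Z * i) - s)]; lia.
Qed.

Lemma dist2N (b : int) : N (- b) = N b.
Proof.
have H a : N (- a) <= N a.
  have [i [s [-> <- _]]] := dist2_spec a.
  by apply: le_trans (dist2_min _ (- i)) _; lia.
by apply/eqP; rewrite eq_le H -{1}[b]opprK H.
Qed.

Lemma dist2_small (b : int) : `|b| <= k%:Z -> N b = `|b|.
Proof.
have [i [s [-> <- sk]]] := dist2_spec b => bk.
have : (i <= -1) || (1 <= i) || (i == 0) by lia.
by nia.
Qed.

Lemma dist2_eq0 (b : int) : (N b == 0) = (2 * k%:Z %| b)%Z.
Proof.
apply/eqP/idP => [|H]; last first.
  by rewrite (@dist2_cong b 0) ?subr0 // dist2_small.
have [i [s [eb <- _]]] := dist2_spec b => s0.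
by apply/dvdzP; exists i; lia.
Qed.

(** Adding [k] exchanges the distance to [0] and the distance to [k], so it reverses which unit
    steps are decreasing; [extendable_one_sign] rests on this reversal. *)
Lemma dist2_shift (b : int) : N (b + k%:Z) = k%:Z - N b.
Proof.
have h : N k%:Z = k%:Z by rewrite dist2_small; lia.
have h1 := dist2D (b + k%:Z) (- b); rewrite addrAC subrr add0r h dist2N in h1.
suff : N (b + k%:Z) <= k%:Z - N b by lia.
have [i [s [-> e sk]]] := dist2_spec b; rewrite -e.
have [s0|s0] := lerP 0 s.
  by apply: le_trans (dist2_min _ (i + 1)) _; lia.
by apply: le_trans (dist2_min _ i) _; lia.
Qed.

Lemma dist2S (b : int) : N (b + 1) = N b + 1 \/ N (b + 1) = N b - 1.
Proof.
have h1 := dist2D b 1; have h2 := dist2D (b + 1) (- 1).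
have h3 := dist2_le_norm 1; have h4 := dist2_le_norm (- 1).
have := dist2_par b; have := dist2_par (b + 1).
rewrite addrK in h2; lia.
Qed.

Lemma dist2B1 (b : int) : N (b - 1) = N b + 1 \/ N (b - 1) = N b - 1.
Proof.
have := dist2S (b - 1); rewrite subrK; lia.
Qed.

(** A step towards the nearest multiple of [2k]; at distance [k] both steps qualify. *)
Lemma dist2_pos_neg (b : int) : N b != 0 -> N (b - 1) = N b - 1 \/ N (b + 1) = N b - 1.
Proof.
have [i [s [eb es sk]]] := dist2_spec b => s0.
have [h|h] := lerP 0 s.
  left; suff : N (b - 1) <= N b - 1 by case: (dist2B1 b); lia.
  by apply: le_trans (dist2_min _ i) _; lia.
right; suff : N (b + 1) <= N b - 1 by case: (dist2S b); lia.
by apply: le_trans (dist2_min _ i) _; lia.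
Qed.

End Dist2.

(** * Edge lists, cuts and orientations *)

Definition crosses (T : finType) (A : {set T}) (e : T * T) : bool :=
  (e.1 \in A) (+) (e.2 \in A).

Definition cut (T : finType) (E : seq (T * T)) (A : {set T}) : int :=
  (count (crosses A) E)%:Z.

Definition net (T : finType) (D : seq (T * T)) (A : {set T}) : int :=
  \sum_(e <- D) ((e.1 \in A)%:Z - (e.2 \in A)%:Z).

Definition vsum (T : finType) (f : T -> int) (A : {set T}) : int :=
  \sum_(v in A) f v.

Definition same_ends (T : finType) (d e : T * T) : bool :=
  (d == e) || (d == (e.2, e.1)).

Definition orients (T : finType) (D E : seq (T * T)) : bool :=
  all2 (@same_ends T) D E.

Definition realizable (T : finType) (m : int) (S : {set T}) (E : seq (T * T))
    (t : T -> int) : Prop :=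
  exists2 D, orients D E & forall v, v \in S -> (m %| net D [set v] - t v)%Z.

Definition inside (T : finType) (S : {set T}) (e : T * T) : bool :=
  (e.1 \in S) && (e.2 \in S).

Section Edges.
Variable T : finType.
Implicit Types (A S : {set T}) (e d : T * T) (D E : seq (T * T)).

Lemma vsum_delta A (x : T) : vsum (fun v => (v == x)%:Z) A = (x \in A)%:Z.
Proof.
rewrite /vsum; have [xA|xA] := boolP (x \in A).
  by rewrite (bigD1 x) //= eqxx big1 ?addr0 // => v /andP[_ /negPf->].
by rewrite big1 // => v vA; case: eqP => // vx; rewrite -vx vA in xA.
Qed.

Lemma eq_vsum A (f g : T -> int) : {in A, f =1 g} -> vsum f A = vsum g A.
Proof. by move=> fg; apply: eq_bigr => v /fg. Qed.

Lemma vsumD A (f g : T -> int) : vsum (fun v => f v + g v) A = vsum f A + vsum g A.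
Proof. exact: big_split. Qed.

Lemma vsumB A (f g : T -> int) : vsum (fun v => f v - g v) A = vsum f A - vsum g A.
Proof. exact: sumrB. Qed.

Lemma vsum1 (f : T -> int) x : vsum f [set x] = f x.
Proof. exact: big_set1. Qed.

Lemma vsum0 A : vsum (fun=> 0) A = 0.
Proof. by rewrite /vsum big1. Qed.

Lemma cut_nil A : cut [::] A = 0. Proof. by []. Qed.

Lemma cut_cons e E A : cut (e :: E) A = (crosses A e)%:Z + cut E A.
Proof. by rewrite /cut /= PoszD. Qed.

Lemma cut_cat E1 E2 A : cut (E1 ++ E2) A = cut E1 A + cut E2 A.
Proof. by rewrite /cut count_cat PoszD. Qed.

Lemma cut_perm E1 E2 A : perm_eq E1 E2 -> cut E1 A = cut E2 A.
Proof. by move=> /seq.permP p; rewrite /cut p. Qed.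

Lemma cut_ge0 E A : 0 <= cut E A. Proof. by []. Qed.

Lemma net_nil A : net [::] A = 0. Proof. by rewrite /net big_nil. Qed.

Lemma net_cons e D A : net (e :: D) A = (e.1 \in A)%:Z - (e.2 \in A)%:Z + net D A.
Proof. by rewrite /net big_cons. Qed.

Lemma net_cat D1 D2 A : net (D1 ++ D2) A = net D1 A + net D2 A.
Proof. by rewrite /net big_cat. Qed.

Lemma net_perm D1 D2 A : perm_eq D1 D2 -> net D1 A = net D2 A.
Proof. by move=> p; rewrite /net; apply: perm_big. Qed.

Lemma net_sum D A : net D A = vsum (fun v => net D [set v]) A.
Proof.
rewrite /vsum /net exchange_big /=; apply: eq_bigr => e _.
rewrite sumrB; congr (_ - _); rewrite -vsum_delta;
  by apply: eq_bigr => v _; rewrite in_set1 eq_sym.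
Qed.

(** Handshaking: the sum counts an edge between distinct vertices of [A] twice, an edge leaving [A]
    once, and a loop never. *)
Lemma vsum_cut_par E A : (2 %| cut E A - vsum (fun v => cut E [set v]) A)%Z.
Proof.
elim: E => [|e E IH].
  by rewrite cut_nil (@eq_vsum _ _ (fun=> 0)) ?vsum0 // => v _; rewrite cut_nil.
have -> : vsum (fun v => cut (e :: E) [set v]) A =
    (e.1 \in A)%:Z + (e.2 \in A)%:Z - 2 * ((e.1 == e.2) && (e.1 \in A))%:Z +
    vsum (fun v => cut E [set v]) A.
  under eq_vsum do rewrite cut_cons.
  rewrite vsumD; congr (_ + _).
  transitivity (vsum (fun v => (v == e.1)%:Z + (v == e.2)%:Z -
      ((e.1 == e.2) && (v == e.1))%:Z - ((e.1 == e.2) && (v == e.1))%:Z) A).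
    apply: eq_vsum => v _; rewrite /crosses !in_set1 ![_ == v]eq_sym.
    have [->|n1] := eqVneq v e.1; first by case: (e.1 == e.2).
    by rewrite andbF; case: (v == e.2).
  rewrite !vsumB vsumD !vsum_delta.
  have [->|_] /= := eqVneq e.1 e.2; first by rewrite vsum_delta; lia.
  by rewrite vsum0; lia.
rewrite cut_cons /crosses.
have [->|_] /= := eqVneq e.1 e.2; first by case: (e.2 \in A) => /=; lia.
by case: (e.1 \in A); case: (e.2 \in A) => /=; lia.
Qed.

Lemma orients_refl E : orients E E.
Proof. by elim: E => //= e E ->; rewrite /same_ends eqxx. Qed.

Lemma orients_cons d D e E : orients (d :: D) (e :: E) = same_ends d e && orients D E.
Proof. by []. Qed.

Lemma orients_cat D1 D2 E1 E2 :
  orients D1 E1 -> orients D2 E2 -> orients (D1 ++ D2) (E1 ++ E2).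
Proof.
elim: D1 E1 => [|d D1 IH] [|e E1] //= /andP[-> o1] o2 /=; exact: IH.
Qed.

Lemma orients_catP D E1 E2 : orients D (E1 ++ E2) ->
  exists D1 D2, [/\ D = D1 ++ D2, orients D1 E1 & orients D2 E2].
Proof.
elim: E1 D => [|e E1 IH] [|d D] //=; first by exists [::], [::].
  by move=> o; exists [::], (d :: D).
move=> /andP[de /IH[D1 [D2 [-> o1 o2]]]].
by exists (d :: D1), D2; split=> //=; rewrite de.
Qed.

Lemma orients_perm D E E' : orients D E -> perm_eq E E' ->
  exists2 D', orients D' E' & perm_eq D D'.
Proof.
elim: E' E D => [|e E' IH] E D o p.
  by move/perm_nilP: p o => ->; case: D => // _; exists [::].
have /splitPr eE : e \in E by rewrite (perm_mem p) mem_head.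
case: eE o p => E1 E2 /orients_catP[D1 [[|d D2] [-> o1]]] //= /andP[de o2] p.
have [|D' o' p'] := IH (E1 ++ E2) (D1 ++ D2) (orients_cat o1 o2).
  by rewrite -(perm_cons e) -(permPr p) perm_sym -[e :: E2]cat1s perm_catCA.
exists (d :: D'); first by rewrite /orients /= de.
by rewrite -[d :: D2]cat1s perm_catCA /= perm_cons.
Qed.

(** Orientations of a contracted graph come from orientations of the original one, edges that have
    become loops included. *)
Lemma orients_map (T' : finType) (f : T' -> T) D (E : seq (T' * T')) :
    let g (e : T' * T') := (f e.1, f e.2) in
  orients D (map g E) -> exists2 D', orients D' E & D = map g D'.
Proof.
move=> g; elim: E D => [|e E IH] [|d D] //=; first by exists [::].
move=> /andP[de /IH[D' o ->]]; case/orP: de => /eqP->.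
  by exists (e :: D') => //=; rewrite /same_ends eqxx.
by exists ((e.2, e.1) :: D') => //=; rewrite /same_ends eqxx orbT.
Qed.

Lemma net_orients D E A : orients D E ->
  `|net D A| <= cut E A /\ (2 %| net D A - cut E A)%Z.
Proof.
elim: E D => [|e E IH] [|d D] //=; first by rewrite net_nil cut_nil.
move=> /andP[de /IH[h1 h2]]; rewrite net_cons cut_cons /crosses.
by case/orP: de => /eqP-> /=; case: (e.1 \in A); case: (e.2 \in A) => /=; lia.
Qed.

Lemma cut_orients D E A : orients D E -> cut D A = cut E A.
Proof.
elim: E D => [|e E IH] [|d D] //=.
move=> /andP[de /IH h]; rewrite !cut_cons h; congr (_ + _).
by case/orP: de => /eqP-> //; rewrite /crosses addbC.
Qed.

Lemma realizable_perm m S E E' t :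
  perm_eq E E' -> realizable m S E t -> realizable m S E' t.
Proof.
move=> p [D o H]; have [D' o' p'] := orients_perm o p.
by exists D' => // v /H; rewrite (net_perm _ p').
Qed.

Lemma cut_inside E S A : all (inside S) E -> cut E (A :&: S) = cut E A.
Proof.
elim: E => //= e E IH /andP[/andP[e1 e2] /IH h]; rewrite !cut_cons h.
by rewrite /crosses !inE e1 e2 !andbT.
Qed.

Lemma net_inside D S A : all (inside S) D -> net D (A :&: S) = net D A.
Proof.
elim: D => [|e E IH] /=; first by rewrite !net_nil.
by move=> /andP[/andP[e1 e2] /IH h]; rewrite !net_cons h !inE e1 e2 !andbT.
Qed.

Lemma orients_inside D E S : orients D E -> all (inside S) D = all (inside S) E.
Proof.
elim: E D => [|e E IH] [|d D] //= /andP[de /IH ->].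
by case/orP: de => /eqP-> //=; rewrite /inside /= [(e.2 \in S) && _]andbC.
Qed.

Lemma cut_S E S : all (inside S) E -> cut E S = 0.
Proof.
move=> /(@cut_inside _ _ setT); rewrite setTI => ->.
by rewrite /cut; elim: E => //= e E; rewrite /crosses !inE.
Qed.

End Edges.

(** * Reordering and reversing edges, lifting, contraction *)

Definition equiv_edges (T : finType) (E E' : seq (T * T)) : Prop :=
  exists2 F, orients F E & perm_eq F E'.

Definition collapse (T : finType) (A : {set T}) (a v : T) : T :=
  if v \in A then a else v.

Definition collapse_edge (T : finType) (A : {set T}) (a : T) (e : T * T) : T * T :=
  (collapse A a e.1, collapse A a e.2).

Lemma has_perm (X : eqType) (P : pred X) (s : seq X) : has P s ->
  exists x s', P x /\ perm_eq s (x :: s').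
Proof.
move=> /hasP[x /splitPr[s1 s2] Px]; exists x, (s1 ++ s2); split=> //.
by rewrite -cat1s perm_catCA.
Qed.

Section Moves.
Variable T : finType.
Implicit Types (A S : {set T}) (e d : T * T) (D E : seq (T * T)).

Lemma same_ends_trans d e f : same_ends d e -> same_ends e f -> same_ends d f.
Proof.
rewrite /same_ends => /orP[]/eqP-> // /orP[]/eqP-> /=; rewrite ?eqxx ?orbT //.
by case: f => f1 f2 /=; rewrite eqxx.
Qed.

Lemma orients_trans D E F : orients D E -> orients E F -> orients D F.
Proof.
elim: F D E => [|f F IH] [|d D] [|e E] //= /andP[h1 h2] /andP[h3 h4].
by rewrite (same_ends_trans h1 h3) /=; apply: IH h2 h4.
Qed.

Lemma orients_size D E : orients D E -> size D = size E.
Proof. by rewrite /orients all2E => /andP[/eqP]. Qed.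

Lemma equiv_cut E E' A : equiv_edges E E' -> cut E' A = cut E A.
Proof. by move=> [F o p]; rewrite -(cut_perm _ p) (cut_orients _ o). Qed.

Lemma equiv_inside E E' S : equiv_edges E E' -> all (inside S) E' = all (inside S) E.
Proof. by move=> [F o p]; rewrite -(perm_all _ p) (orients_inside _ o). Qed.

Lemma equiv_size E E' : equiv_edges E E' -> size E' = size E.
Proof. by move=> [F o p]; rewrite -(perm_size p) (orients_size o). Qed.

Lemma equiv_realizable m S E E' t : equiv_edges E E' ->
  realizable m S E' t -> realizable m S E t.
Proof.
move=> [F o p]; rewrite perm_sym in p => /(realizable_perm p)[D oD H].
by exists D => //; apply: orients_trans oD o.
Qed.

Lemma perm_equiv E E' : perm_eq E E' -> equiv_edges E E'.
Proof. by move=> p; exists E => //; apply: orients_refl. Qed.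

Lemma equiv_edges_refl E : equiv_edges E E.
Proof. exact: perm_equiv. Qed.

Lemma equiv_edges_trans E1 E2 E3 : equiv_edges E1 E2 -> equiv_edges E2 E3 -> equiv_edges E1 E3.
Proof.
move=> [F oF pF] [G oG pG]; rewrite perm_sym in pF.
have [G' oG' pG'] := orients_perm oG pF.
by exists G'; [apply: orients_trans oG' oF | rewrite -(permPl pG')].
Qed.

Lemma equiv_cat E1 E2 E1' E2' : equiv_edges E1 E1' -> equiv_edges E2 E2' ->
  equiv_edges (E1 ++ E2) (E1' ++ E2').
Proof.
move=> [F oF pF] [G oG pG]; exists (F ++ G); first exact: orients_cat.
exact: perm_cat.
Qed.

Lemma pick_cross_in x B E : has (fun e => crosses [set x] e && crosses B e) E ->
  exists y E', [/\ y != x, crosses B (x, y) & equiv_edges E ((x, y) :: E')].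
Proof.
move=> /has_perm[[a b] [E' []]]; rewrite /crosses !in_set1 /=.
have [<- /andP[ba hB] p|ax] /= := eqVneq a x.
  by exists b, E'; split; [| |apply: perm_equiv].
move=> /andP[/eqP eb hB] p; exists a, E'; split=> //; first by rewrite -eb addbC.
have o : orients ((b, a) :: E') ((a, b) :: E').
  by rewrite orients_cons orients_refl /same_ends eqxx orbT.
rewrite perm_sym in p; have [F oF pF] := orients_perm o p.
by exists F => //; rewrite perm_sym -eb.
Qed.

Lemma pick_cross x E : has (crosses [set x]) E ->
  exists y E', y != x /\ equiv_edges E ((x, y) :: E').
Proof.
move=> hx; have [|y [E' [yx _ ev]]] := @pick_cross_in x [set x] E; last by exists y, E'.
by rewrite (eq_has (a2 := crosses [set x])) // => e; rewrite /= andbb.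
Qed.

Lemma realizable_loop m S x E t :
  realizable m S E t -> realizable m S ((x, x) :: E) t.
Proof.
move=> [D o H]; exists ((x, x) :: D) => [|v /H].
  by rewrite orients_cons /same_ends eqxx.
by rewrite net_cons /= subrr add0r.
Qed.

(** The arc between [y] and [z] is rerouted through [x], which gains one arc in and one arc out; no
    net degree changes. *)
Lemma realizable_lift m S x y z E t :
  realizable m S ((y, z) :: E) t -> realizable m S ((x, y) :: (x, z) :: E) t.
Proof.
move=> [[|d D] //]; rewrite orients_cons => /andP[de o] H.
case/orP: de H => /eqP-> H.
  exists ((y, x) :: (x, z) :: D) => [|v /H].
    by rewrite !orients_cons /same_ends !eqxx orbT.
  by rewrite !net_cons /=; congr (_ %| _)%Z; lia.
exists ((x, y) :: (z, x) :: D) => [|v /H].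
  by rewrite !orients_cons /same_ends !eqxx orbT.
by rewrite !net_cons /=; congr (_ %| _)%Z; lia.
Qed.

Lemma orient_bundle x E (s : int) : all (crosses [set x]) E ->
  `|s| <= (size E)%:Z -> (2 %| s - (size E)%:Z)%Z ->
  exists2 D, orients D E & net D [set x] = s.
Proof.
elim: E s => [|e E IH] s /=; first by exists [::]; rewrite ?net_nil //; lia.
move=> /andP[xe aE] h1 h2; have [s0|s0] := ltrP 0 s.
  have [||D o eD] := IH (s - 1) aE; [lia|lia|].
  exists ((if e.1 == x then e else (e.2, e.1)) :: D).
    rewrite orients_cons o andbT /same_ends.
    by case: ifP; rewrite eqxx ?orbT.
  rewrite net_cons eD; move: xe; rewrite /crosses !in_set1.
  by case: (eqVneq e.1 x) => [->|/negPf n] /= h; rewrite ?n ?in_set1 ?eqxx;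
    rewrite ?(negPf h) ?(eqP h) ?eqxx ?n; lia.
have [||D o eD] := IH (s + 1) aE; [lia|lia|].
exists ((if e.1 == x then (e.2, e.1) else e) :: D).
  rewrite orients_cons o andbT /same_ends.
  by case: ifP; rewrite eqxx ?orbT.
rewrite net_cons eD; move: xe; rewrite /crosses !in_set1.
by case: (eqVneq e.1 x) => [->|/negPf n] /= h; rewrite ?n ?in_set1 ?eqxx;
  rewrite ?(negPf h) ?(eqP h) ?eqxx ?n; lia.
Qed.

Lemma cut_map (f : T -> T) E A :
  cut [seq (f e.1, f e.2) | e <- E] A = cut E (f @^-1: A).
Proof.
rewrite /cut count_map; congr Posz; apply: eq_count => e /=.
by rewrite /crosses !inE.
Qed.

Lemma net_map (f : T -> T) D A :
  net [seq (f e.1, f e.2) | e <- D] A = net D (f @^-1: A).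
Proof. by rewrite /net big_map; apply: eq_bigr => e _; rewrite !inE. Qed.

Lemma collapse_pre1 A a : a \in A -> collapse A a @^-1: [set a] = A.
Proof.
move=> aA; apply/setP => v; rewrite !inE /collapse.
by case: ifP => vA; rewrite ?eqxx //; apply/eqP => va; rewrite va aA in vA.
Qed.

Lemma collapse_pre A a (B : {set T}) : a \in A -> B \subset a |: ~: A ->
  collapse A a @^-1: B = if a \in B then B :|: A else B.
Proof.
move=> aA /subsetP sB; apply/setP => v; rewrite !inE /collapse.
case: ifP => vA; case: ifP => aB; rewrite ?inE ?vA ?orbT ?orbF //.
apply/esym/negbTE/negP => vB; have := sB v vB.
by rewrite !inE vA orbF => /eqP va; rewrite -va vB in aB.
Qed.

Lemma vsum_cut E A (B : {set T}) : all (fun e => ~~ inside A e) E -> B \subset A ->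
  vsum (fun v => cut E [set v]) B = cut E B.
Proof.
move=> + sBA; elim: E => [|e E IH] /=.
  by rewrite cut_nil (@eq_vsum _ _ _ (fun=> 0)) ?vsum0 // => v _; rewrite cut_nil.
move=> /andP[eA /IH h]; under eq_vsum do rewrite cut_cons.
rewrite vsumD {}h cut_cons; congr (_ + _).
have -> : (crosses B e)%:Z = (e.1 \in B)%:Z + (e.2 \in B)%:Z :> int.
  rewrite /crosses; move: eA; rewrite /inside.
  have := subsetP sBA e.1; have := subsetP sBA e.2.
  case: (e.1 \in B); case: (e.2 \in B) => //= h1 h2.
  by rewrite h1 ?h2.
rewrite -!vsum_delta -vsumD; apply: eq_vsum => v vB.
rewrite /crosses !in_set1 ![_ == v]eq_sym.
case: (eqVneq v e.1) => [v1|]; case: (eqVneq v e.2) => [v2|] //=.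
move: eA; rewrite /inside -v1 -v2 (subsetP sBA _ vB) //.
Qed.

Lemma net_S D S : all (inside S) D -> net D S = 0.
Proof.
elim: D => [|e D IH] /=; first by rewrite net_nil.
by move=> /andP[/andP[e1 e2] /IH h]; rewrite net_cons h e1 e2.
Qed.

(* Contract [A] to [a] first; the edges of [R] at [A] are then oriented, and
   what remains to be done at [v] in [A] is [t v - c v]. *)
Lemma realizable_glue m S A a EA R t :
  A \subset S -> a \in A -> all (inside A) EA ->
  all (fun e => ~~ inside A e) R ->
  realizable m (a |: (S :\: A)) (map (collapse_edge A a) (EA ++ R))
    (fun v => if v == a then vsum t A else t v) ->
  (forall c : T -> int,
     (forall v, v \in A -> `|c v| <= cut R [set v] /\ (2 %| c v - cut R [set v])%Z) ->
     (m %| vsum (fun v => t v - c v) A)%Z ->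
     realizable m A EA (fun v => t v - c v)) ->
  realizable m S (EA ++ R) t.
Proof.
move=> sAS aA inA outA [D0 o0 H0] HA.
have [D oD eD0] := orients_map o0; rewrite {}eD0 {o0} in H0.
have {H0} H v : v \in a |: (S :\: A) ->
    (m %| net D (collapse A a @^-1: [set v]) - (if v == a then vsum t A else t v))%Z.
  by move=> /H0; rewrite net_map.
have [D1 [D2 [eD o1 o2]]] := orients_catP oD.
have D1A : net D1 A = 0 by rewrite net_S // (orients_inside _ o1).
have [||D3 o3 H3] := HA (fun v => net D2 [set v]).
- by move=> v vA; apply: net_orients.
- rewrite vsumB -net_sum.
  have := H a; rewrite !inE eqxx collapse_pre1 //= eD net_cat D1A add0r => /(_ isT).
  by rewrite -opprB rpredN.
exists (D3 ++ D2); first exact: orients_cat.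
move=> v vS; rewrite net_cat; have [vA|vA] := boolP (v \in A).
  by have := H3 v vA; congr (_ %| _)%Z; lia.
have va : v != a by apply: contraNneq vA => ->.
have off X : all (inside A) X -> net X [set v] = 0.
  move=> /(@net_inside _ _ _ [set v]) <-.
  rewrite (_ : _ :&: _ = set0) ?net_sum /vsum ?big_set0 //.
  by apply/setP => u; rewrite !inE; case: eqP => // ->; rewrite (negPf vA).
rewrite off ?(orients_inside _ o3) // add0r.
have := H v; rewrite !inE (negPf va) vA vS /= => /(_ isT).
have -> : collapse A a @^-1: [set v] = [set v].
  rewrite collapse_pre // ?in_set1 1?eq_sym ?(negPf va) //.
  by apply/subsetP => u; rewrite !inE => /eqP->; rewrite vA orbT.
by rewrite eD net_cat off ?add0r // (orients_inside _ o1).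
Qed.

End Moves.

(** * Extension of a pre-orientation at a root *)

(* A graph on [S] together with a root [z0] outside [S] is encoded by the list [E] of
   its edges inside [S], the number [q v] of edges joining [v] to [z0], and the net
   number [c v] of those that are oriented from [v] to [z0].  [t] is the net degree,
   modulo [2k], to be realized by the edges of [E] alone, so that [t v + c v] is the
   net degree prescribed at [v]. *)
Record balanced (T : finType) (k : nat) (S : {set T}) (E : seq (T * T))
    (t q c : T -> int) : Prop := Balanced {
  bal_in : all (inside S) E;
  bal_sum : (2 * k%:Z %| vsum t S)%Z;
  bal_part : forall v, v \in S -> (2 %| t v - cut E [set v])%Z;
  bal_parc : forall v, v \in S -> (2 %| c v - q v)%Z;
  bal_abs : forall v, v \in S -> `|c v| <= q v }.

Definition bdeg (T : finType) (E : seq (T * T)) (q : T -> int) (A : {set T}) : int :=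
  cut E A + vsum q A.

Definition demand (T : finType) (t c : T -> int) (A : {set T}) : int :=
  vsum t A + vsum c A.

Definition exempt (T : finType) (v0 : option T) (A : {set T}) : bool :=
  if v0 is Some x then A == [set x] else false.

(* The exempt vertex [v0], of prescribed net degree [0], may have small degree; this
   allows its edges to be lifted until it is isolated. *)
Record extendable (T : finType) (k : nat) (S : {set T}) (E : seq (T * T))
    (t q c : T -> int) (v0 : option T) : Prop := Extendable {
  ext_bal : balanced k S E t q c;
  ext_root : vsum q S <= 2 * k%:Z - 2 + dist2 k (vsum c S);
  ext_cut : forall A, A != set0 -> A \proper S -> ~~ exempt v0 A ->
    2 * k%:Z - 2 + dist2 k (demand t c A) <= bdeg E q A;
  ext_zero : forall x, v0 = Some x -> x \in S -> dist2 k (t x + c x) = 0 }.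

Lemma card_collapse (T : finType) (S A : {set T}) a : A \subset S -> a \in A -> (1 < #|A|)%N ->
  (#|a |: (S :\: A)| < #|S|)%N.
Proof.
move=> sA aA A1; rewrite cardsU1 !inE aA /= cardsD (setIidPr sA).
by have := subset_leq_card sA; lia.
Qed.

Section Glue.
Variables (T : finType) (k : nat).
Hypothesis k_gt0 : (0 < k)%N.
Implicit Types (A B S : {set T}) (e d : T * T) (D E R : seq (T * T)).
Implicit Types (t q c : T -> int).
Notation N := (dist2 k).

Lemma vsum_par (B : {set T}) (f g : T -> int) :
  (forall v, v \in B -> (2 %| f v - g v)%Z) -> (2 %| vsum f B - vsum g B)%Z.
Proof. by move=> H; rewrite -vsumB; apply: rpred_sum => v /H. Qed.

Lemma balanced_part S E t q c A : balanced k S E t q c -> A \subset S ->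
  (2 %| vsum t A - cut E A)%Z.
Proof.
move=> b /subsetP sA; have h := vsum_cut_par E A.
have := @vsum_par A t (fun v => cut E [set v]) (fun v vA => bal_part b (sA v vA)).
lia.
Qed.

Lemma balanced_parc S E t q c A : balanced k S E t q c -> A \subset S ->
  (2 %| vsum c A - vsum q A)%Z.
Proof. by move=> b /subsetP sA; apply: vsum_par => v /sA; apply: bal_parc b _. Qed.

Lemma balanced_abs S E t q c A : balanced k S E t q c -> A \subset S ->
  `|vsum c A| <= vsum q A.
Proof.
move=> b /subsetP sA; apply: le_trans (ler_norm_sum _ _ _) _.
by apply: ler_sum => v /sA; apply: bal_abs b _.
Qed.

Lemma balanced_par S E t q c A : balanced k S E t q c -> A \subset S ->
  (2 %| N (demand t c A) - bdeg E q A)%Z.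
Proof.
move=> b sA; have := dist2_par k_gt0 (demand t c A).
have := balanced_part b sA; have := balanced_parc b sA.
rewrite /demand /bdeg; lia.
Qed.

Lemma vsum_collapse A a B (f : T -> int) : a \in A -> B \subset a |: ~: A ->
  vsum (fun v => if v == a then vsum f A else f v) B =
  vsum f (collapse A a @^-1: B).
Proof.
rewrite /vsum; move=> aA sB; rewrite collapse_pre //; case: ifP => aB.
  have nA v : v \in B -> v != a -> v \notin A.
    by move=> /(subsetP sB); rewrite !inE => /orP[->|].
  rewrite (bigD1 a) //= eqxx addrC [RHS](bigID (mem A)) /= addrC; congr (_ + _).
    by apply: eq_bigl => v; rewrite inE; case: (v \in A); rewrite ?orbT ?andbF.
  under [LHS]eq_bigr => v /andP[_ /negPf->] do [].
  apply: eq_bigl => v; rewrite !inE; have [vA|vA] := boolP (v \in A).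
    by rewrite andbF; apply/negbTE/negP => /andP[vB va]; move: (nA _ vB va); rewrite vA.
  by rewrite orbF andbT; case: eqP => [va|_]; [rewrite va aA in vA | rewrite andbT].
by apply: eq_bigr => v vB; case: eqP => // va; rewrite -va vB in aB.
Qed.

(** Once the contraction is oriented, everything outside [A] acts as the root of [A]: the edges of
    [R] at [v] join its root edges and their net number moves from [t] to [c]. Degrees and demands
    of subsets of [A] are unchanged, so the assumed upper bound on [A] becomes the root bound. *)
Lemma extendable_glue S A a EA R t q c v0 :
  balanced k S (EA ++ R) t q c -> A \subset S -> a \in A ->
  all (inside A) EA -> all (fun e => ~~ inside A e) R ->
  bdeg (EA ++ R) q A <= 2 * k%:Z - 2 + N (demand t c A) ->
  (forall B, B != set0 -> B \proper A -> ~~ exempt v0 B ->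
     2 * k%:Z - 2 + N (demand t c B) <= bdeg (EA ++ R) q B) ->
  (forall x, v0 = Some x -> x \in A -> N (t x + c x) = 0) ->
  realizable (2 * k%:Z) (a |: (S :\: A)) (map (collapse_edge A a) (EA ++ R))
    (fun v => if v == a then vsum t A else t v) ->
  (forall t' q' c', extendable k A EA t' q' c' v0 -> realizable (2 * k%:Z) A EA t') ->
  realizable (2 * k%:Z) S (EA ++ R) t.
Proof.
move=> b sAS aA inA outA lA cB z0 H1 H2.
apply: (realizable_glue sAS aA inA outA H1) => c' hc' sc'.
have degB B : B \subset A ->
    bdeg EA (fun v => q v + cut R [set v]) B = bdeg (EA ++ R) q B.
  move=> sB; rewrite /bdeg vsumD (vsum_cut outA sB) cut_cat; lia.
have demB B : demand (fun v => t v - c' v) (fun v => c v + c' v) B = demand t c B.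
  by rewrite /demand vsumB vsumD; lia.
apply: (H2 _ (fun v => q v + cut R [set v]) (fun v => c v + c' v)); split.
- split=> // v vA; have vS := subsetP sAS v vA; have [h1 h2] := hc' v vA.
  + have := bal_part b vS; rewrite cut_cat; lia.
  + have := bal_parc b vS; lia.
  + have := bal_abs b vS; lia.
- rewrite (_ : N _ = N (demand t c A)); last first.
    apply: dist2_cong => //; rewrite -opprB rpredN.
    by move: sc'; rewrite vsumB vsumD /demand; congr (_ %| _)%Z; lia.
  by have := degB A (subxx _); rewrite /bdeg cut_S // add0r => ->.
- move=> B B0 pB eB; rewrite demB degB ?(proper_sub pB) //; exact: cB.
- by move=> x e xA; rewrite -(z0 x e xA); congr N; lia.
Qed.

Section Collapse.
Variables (S A : {set T}) (a : T).
Hypotheses (sA : A \subset S) (aA : a \in A).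
Let push (f : T -> int) v := if v == a then vsum f A else f v.

Let sub B : B \subset a |: (S :\: A) -> B \subset a |: ~: A.
Proof.
move=> sB; apply: subset_trans sB _; apply: setUS.
by apply/subsetP => v; rewrite !inE => /andP[].
Qed.

Lemma collapse_sub B : B \subset a |: (S :\: A) -> collapse A a @^-1: B \subset S.
Proof.
move=> sB; rewrite collapse_pre ?sub //.
have sBS : B \subset S.
  apply: subset_trans sB _; rewrite subUset sub1set (subsetP sA) //=; exact: subsetDl.
by case: ifP => // _; rewrite subUset sBS.
Qed.

Lemma collapse_preT : collapse A a @^-1: (a |: (S :\: A)) = S.
Proof.
rewrite collapse_pre ?sub // !inE eqxx /=.
apply/setP => v; rewrite !inE; have [vA|vA] := boolP (v \in A).
  by rewrite orbT (subsetP sA).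
by rewrite orbF /=; case: eqP => // ->; rewrite (subsetP sA).
Qed.

Lemma collapse_proper B : B \proper a |: (S :\: A) -> collapse A a @^-1: B \proper S.
Proof.
move=> pB; rewrite properE collapse_sub ?(proper_sub pB) //=.
have /properP[_ [v vS vB]] := pB; apply/subsetPn; exists v.
  rewrite -collapse_preT inE; move: vS; rewrite !inE /collapse.
  by case: ifP => vA; rewrite ?eqxx ?vA.
rewrite !inE /collapse; case: ifP => // vA.
by move: vS; rewrite !inE vA orbF => /eqP va; rewrite -va.
Qed.

Lemma collapse_neq0 B : B \subset a |: (S :\: A) -> B != set0 ->
  collapse A a @^-1: B != set0.
Proof.
move=> sB B0; rewrite collapse_pre ?sub //; case: ifP => // _.
by apply/set0Pn; exists a; rewrite inE aA orbT.
Qed.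

Lemma vsum_push f B : B \subset a |: (S :\: A) ->
  vsum (push f) B = vsum f (collapse A a @^-1: B).
Proof. by move=> /sub; apply: vsum_collapse. Qed.

Lemma cut_collapse E B : cut (map (collapse_edge A a) E) B = cut E (collapse A a @^-1: B).
Proof. exact: cut_map. Qed.

Lemma inside_collapse E : all (inside S) E ->
  all (inside (a |: (S :\: A))) (map (collapse_edge A a) E).
Proof.
move=> iE; rewrite all_map; apply/allP => e eE; have /andP[e1 e2] := allP iE e eE.
rewrite /= /inside /= /collapse.
by case: ifP => h1; case: ifP => h2; rewrite !inE ?eqxx ?h1 ?h2 ?e1 ?e2 ?orbT.
Qed.

Lemma balanced_collapse E t q c : balanced k S E t q c ->
  balanced k (a |: (S :\: A)) (map (collapse_edge A a) E) (push t) (push q) (push c).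
Proof.
move=> b.
have push1 f v : v \in a |: (S :\: A) ->
    push f v = vsum f (collapse A a @^-1: [set v]).
  by move=> vS; rewrite -vsum_push ?sub1set // vsum1.
split.
- exact: inside_collapse (bal_in b).
- by rewrite vsum_push // collapse_preT (bal_sum b).
- move=> v vS; rewrite push1 // cut_collapse; apply: balanced_part b _.
  by rewrite collapse_sub // sub1set.
- move=> v vS; rewrite !push1 //; apply: balanced_parc b _.
  by rewrite collapse_sub // sub1set.
- move=> v vS; rewrite !push1 //; apply: balanced_abs b _.
  by rewrite collapse_sub // sub1set.
Qed.

(** Sets of the contraction are read as their preimages, with the same degree and demand. A preimage
    containing [A] is not a singleton, hence never exempt; the condition on [v0] keeps the exemption
    off the contracted vertex, whose demand is that of all of [A]. *)
Lemma extendable_collapse E t q c v0 :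
  extendable k S E t q c v0 -> (1 < #|A|)%N -> v0 != Some a ->
  extendable k (a |: (S :\: A)) (map (collapse_edge A a) E)
    (push t) (push q) (push c) v0.
Proof.
move=> [b hz hc h0] A1 v0a.
split; first exact: balanced_collapse.
- by rewrite !vsum_push // collapse_preT.
- move=> B B0 pB xB; have sB := proper_sub pB.
  rewrite /demand /bdeg cut_collapse !vsum_push //; apply: hc.
  + exact: collapse_neq0.
  + exact: collapse_proper.
  + case: v0 xB v0a {h0} => //= x xB xa; rewrite collapse_pre ?sub //.
    case: ifP => // aB; apply/negP => /eqP e.
    move: A1; rewrite ltnNge => /negP; apply; rewrite -(cards1 x) -e.
    by apply: subset_leq_card; apply: subsetUr.
- move=> x ex; rewrite !inE; have xa : x != a by apply: contraNneq v0a => <-; rewrite ex.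
  by rewrite (negPf xa) /= => /andP[xA xS]; rewrite /push (negPf xa) h0.
Qed.

End Collapse.

End Glue.

Section MoreMoves.
Variable T : finType.
Implicit Types (A B P S : {set T}) (e d : T * T) (D E R : seq (T * T)).

Lemma vsum_upd (f : T -> int) (a : int) x A :
  vsum (fun v => f v + a * (v == x)%:Z) A = vsum f A + a * (x \in A)%:Z.
Proof. by rewrite vsumD -vsum_delta /vsum -mulr_sumr. Qed.

Lemma vsum_setD (f : T -> int) A S : A \subset S -> vsum f S = vsum f A + vsum f (S :\: A).
Proof.
move=> sA; rewrite /vsum (bigID (mem A)) /=; congr (_ + _); apply: eq_bigl => v.
  by rewrite andb_idl // => /(subsetP sA).
by rewrite !inE andbC.
Qed.

Lemma cut_setD E A S : all (inside S) E -> A \subset S -> cut E (S :\: A) = cut E A.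
Proof.
move=> iE /subsetP sA; rewrite /cut; congr Posz; apply: eq_in_count => e /(allP iE).
by rewrite /crosses !inE => /andP[-> ->]; rewrite !andbT; case: (_ \in A); case: (_ \in A).
Qed.

Lemma realizable_arc m S x y E t (s : int) : s = 1 \/ s = -1 ->
  realizable m S E (fun v => t v + - s * (v == x)%:Z + s * (v == y)%:Z) ->
  realizable m S ((x, y) :: E) t.
Proof.
move=> hs [D o H].
exists ((if s == 1 then (x, y) else (y, x)) :: D) => [|v /H].
  by rewrite orients_cons /same_ends o; case: ifP; rewrite eqxx ?orbT.
rewrite net_cons; case: hs => -> /=; rewrite !in_set1 ![_ == v]eq_sym;
 by congr (_ %| _)%Z; lia.
Qed.

Lemma inside_isolated S x E : all (inside S) E ->
  all (fun e => e.1 != e.2) E -> cut E [set x] = 0 -> all (inside (S :\: [set x])) E.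
Proof.
move=> iE nl [cx]; apply/allP => e eE; have /andP[e1 e2] := allP iE e eE.
have : ~~ has (crosses [set x]) E by rewrite has_count -leqNgt leqn0 cx.
move=> /hasPn/(_ e eE); have := allP nl e eE.
rewrite /crosses /inside !inE e1 e2 !andbT.
have [e1x|n1] := eqVneq e.1 x; have [e2x|n2] := eqVneq e.2 x => //=.
by rewrite e1x e2x eqxx.
Qed.

Lemma realizable_isolated m S x E t : cut E [set x] = 0 -> (m %| t x)%Z ->
  realizable m (S :\: [set x]) E t -> realizable m S E t.
Proof.
move=> cx tx [D oD HD]; exists D => // v vS.
have [->|vx] := eqVneq v x; last by apply: HD; rewrite !inE vx.
have [h _] := net_orients [set x] oD; rewrite (_ : net _ _ = 0) ?sub0r ?rpredN //.
by move: h; rewrite cx; clear; lia.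
Qed.

End MoreMoves.

(** * Slack, connectedness and the case of two vertices *)

Section Steps.
Variables (T : finType) (k : nat).
Hypothesis k_gt1 : (1 < k)%N.
Implicit Types (A B P S : {set T}) (e d : T * T) (D E R : seq (T * T)).
Implicit Types (t q c : T -> int) (s : int).
Notation N := (dist2 k).
Let k_gt0 : (0 < k)%N. Proof. exact: ltnW. Qed.

Lemma demand1 t c x : demand t c [set x] = t x + c x.
Proof. by rewrite /demand !vsum1. Qed.

Lemma bdeg1 E q x : bdeg E q [set x] = cut E [set x] + q x.
Proof. by rewrite /bdeg vsum1. Qed.

Lemma dist2_demandS S E t q c : balanced k S E t q c -> N (vsum c S) = N (demand t c S).
Proof.
move=> b; apply: dist2_cong => //; rewrite /demand -opprB rpredN addrK; exact: bal_sum b.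
Qed.

Lemma dist2_sign b s : s = 1 \/ s = -1 -> N (b + s) <= N b + 1.
Proof. by case=> ->; [case: (dist2S k_gt0 b) | case: (dist2B1 k_gt0 b)]; lia. Qed.

Lemma dist2_shift_sign b s : s = 1 \/ s = -1 -> N (b + s * k%:Z) = k%:Z - N b.
Proof.
move=> hs; rewrite -dist2_shift //; apply: dist2_cong => //.
case: hs => ->; first by rewrite mul1r subrr.
by apply/dvdzP; exists (- 1); lia.
Qed.

Lemma balanced_equiv S E E' t q c : equiv_edges E E' ->
  balanced k S E t q c -> balanced k S E' t q c.
Proof.
move=> h [h1 h2 h3 h4 h5]; split=> //; first by rewrite (equiv_inside _ h).
by move=> v; rewrite (equiv_cut _ h); apply: h3.
Qed.

Lemma extendable_equiv S E E' t q c v0 : equiv_edges E E' ->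
  extendable k S E t q c v0 -> extendable k S E' t q c v0.
Proof.
move=> h [h1 h2 h3 h4]; split=> //; first exact: balanced_equiv h h1.
by move=> A; rewrite /bdeg (equiv_cut _ h); apply: h3.
Qed.

Lemma extendable_loop S x E t q c v0 :
  extendable k S ((x, x) :: E) t q c v0 -> extendable k S E t q c v0.
Proof.
have ce A : cut ((x, x) :: E) A = cut E A by rewrite cut_cons /crosses addbb add0r.
move=> [[h1 h2 h3 h4 h5] hz hc h0]; split=> //.
  split=> //; first by case/andP: h1.
  by move=> v; rewrite -ce; apply: h3.
by move=> A; rewrite /bdeg -ce; apply: hc.
Qed.

(** The bound of [ext_cut] raised by two, which is the most a single move can cost: two edges lost,
    or one edge lost and the demand raised by one. *)
Definition slack S E t q c := forall A, A \proper S -> (1 < #|A|)%N ->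
  2 * k%:Z + N (demand t c A) <= bdeg E q A.

Lemma slack_equiv S E E' t q c : equiv_edges E E' -> slack S E t q c -> slack S E' t q c.
Proof. by move=> h sl A pA A1; rewrite /bdeg (equiv_cut _ h); apply: sl. Qed.

(** Without edges between [P] and the rest of [S], all their outgoing edges are root edges. Their
    two lower bounds then add up to more than the root bound, [dist2] being subadditive and
    [k > 1]. *)
Lemma connected_ext S E t q c P : extendable k S E t q c None -> P \subset S ->
  P != set0 -> cut E P = 0 -> P = S.
Proof.
move=> [b hz hc _] sP P0 cP; apply/eqP; apply: contraT => nP.
have pP : P \proper S by rewrite properEneq nP.
have pD : S :\: P \proper S.
  rewrite properE subsetDl; apply/subsetPn.
  have [v vP] := set0Pn _ P0; exists v; first exact: (subsetP sP).
  by rewrite inE vP.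
have D0 : S :\: P != set0 by rewrite setD_eq0; have /andP[] := pP.
have := hc _ P0 pP isT; have := hc _ D0 pD isT.
rewrite /bdeg (cut_setD (bal_in b)) // cP !add0r.
move: hz; rewrite (dist2_demandS b) (vsum_setD q sP).
have -> : demand t c S = demand t c P + demand t c (S :\: P).
  by rewrite /demand (vsum_setD t sP) (vsum_setD c sP); lia.
by have := dist2D k_gt0 (demand t c P) (demand t c (S :\: P)); lia.
Qed.

(** All edges are parallel, so only the net degree [s] at [x] has to be chosen; comparing the vertex
    bounds with the root bound shows that there are enough edges. *)
Lemma realizable_two S E t q c v0 : extendable k S E t q c v0 ->
  all (fun e => e.1 != e.2) E -> #|S| = 2 -> realizable (2 * k%:Z) S E t.
Proof.
move=> [b hz hc h0] nl /eqP/cards2P[x [y [xy eS]]].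
have xS : x \in S by rewrite eS !inE eqxx.
have yS : y \in S by rewrite eS !inE eqxx orbT.
have inE2 v : v \in S -> (v == x) || (v == y) by rewrite eS !inE.
have aE : all (crosses [set x]) E.
  apply/allP => e eE; have := allP nl e eE; have := allP (bal_in b) e eE.
  rewrite /inside /crosses !in_set1 => /andP[/inE2 e1 /inE2 e2].
  by case/orP: e1 => /eqP->; case/orP: e2 => /eqP->;
    rewrite ?eqxx // 1?eq_sym ?(negPf xy) //= eq_sym (negPf xy).
have cx : cut E [set x] = (size E)%:Z by rewrite /cut; move: aE; rewrite all_count => /eqP->.
have sD : S :\: [set x] = [set y].
  by apply/setP => v; rewrite eS !inE; case: eqP => //= ->; rewrite (negPf xy).
have sx : [set x] \subset S by rewrite sub1set.
have cy : cut E [set y] = (size E)%:Z by rewrite -cx -(cut_setD (bal_in b) sx) sD.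
have sumS f : vsum f S = f x + f y by rewrite (vsum_setD f sx) sD !vsum1.
suff [s [hs1 hs2 hs3]] : exists s : int,
    [/\ `|s| <= (size E)%:Z, (2 %| s - (size E)%:Z)%Z & (2 * k%:Z %| s - t x)%Z].
  have [D oD nD] := orient_bundle aE hs1 hs2; exists D => // v.
  rewrite eS !inE => /orP[/eqP->|/eqP->]; first by rewrite nD.
  have := net_S (etrans (orients_inside S oD) (bal_in b)); rewrite net_sum sumS nD => h.
  have -> : net D [set y] - t y = - (s - t x) - (t x + t y) by lia.
  by rewrite rpredB ?rpredN //; have := bal_sum b; rewrite sumS.
have px : [set x] \proper S.
  by rewrite properE sx; apply/subsetPn; exists y; rewrite // inE eq_sym.
have py : [set y] \proper S.
  by rewrite properE sub1set yS; apply/subsetPn; exists x; rewrite // inE.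
have dS : demand t c S = (t x + c x) + (t y + c y) by rewrite /demand !sumS; lia.
have ND := dist2D k_gt0 (t x + c x) (t y + c y).
move: hz; rewrite (dist2_demandS b) dS sumS => hz.
have tx := bal_part b xS; have cqx := bal_parc b xS; have aqx := bal_abs b xS.
have ty := bal_part b yS; have cqy := bal_parc b yS; have aqy := bal_abs b yS.
have set10 (z : T) : [set z] != set0 by rewrite -cards_eq0 cards1.
have cutx := hc _ (set10 x) px; have cuty := hc _ (set10 y) py.
move: cutx cuty; rewrite !demand1 !bdeg1 cx cy => cutx cuty; rewrite cx in tx; rewrite cy in ty.
case: (v0 =P Some x) => [ex|nx].
  have := h0 x ex xS => N0; have := N0 => /eqP; rewrite dist2_eq0 // => /dvdzP[j ej].
  have {}cuty : 2 * k%:Z - 2 + N (t y + c y) <= (size E)%:Z + q y.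
    by apply: cuty; rewrite ex /= -(inj_eq (@set1_inj _)) in xy *; rewrite eq_sym.
  (* The prescribed net degree at [x] being [0], [E] has to compensate the root edges at [x]; the
     bounds at [y] and at the root give [q x <= size E]. *)
  exists (- c x); split.
  - by move: aqx cuty hz ND; rewrite N0; clear; lia.
  - by move: tx cqx aqx cuty hz ND ej; clear; lia.
  by apply/dvdzP; exists (- j); move: ej; clear; lia.
case: (v0 =P Some y) => [ey|ny].
  have := h0 y ey yS => N0; have := N0 => /eqP; rewrite dist2_eq0 // => /dvdzP[j ej].
  have {}cutx : 2 * k%:Z - 2 + N (t x + c x) <= (size E)%:Z + q x.
    by apply: cutx; rewrite ey /= -(inj_eq (@set1_inj _)) in xy *.
  have := bal_sum b; rewrite sumS => /dvdzP[i ei].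
  exists (c y); split.
  - by move: aqy cutx hz ND; rewrite N0; clear; lia.
  - by move: ty cqy ej; clear; lia.
  by apply/dvdzP; exists (j - i); move: ej ei; clear; lia.
have nex z : v0 <> Some z -> ~~ exempt v0 [set z].
  by case: v0 {h0 hc nx ny cutx cuty} => //= a az;
    apply/negP => /eqP/set1_inj e; case: az; rewrite e.
have {}cutx := cutx (nex x nx); have {}cuty := cuty (nex y ny).
(* The two vertex bounds and the root bound give [size E >= k - 1]. As [s] has the parity of
   [size E], the value [k] for its norm does not occur with [size E = k - 1]. *)
have [j [s [ej es sk]]] := dist2_spec k_gt0 (t x).
exists s; split.
- have := dist2_lek k_gt0 (t x).
  by move: es cutx cuty hz ND tx ej; clear; lia.
- by move: tx ej; clear; lia.
by apply/dvdzP; exists (- j); move: ej; clear; lia.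
Qed.
End Steps.

(** * Contracting, orienting and lifting under the induction hypothesis *)

Section Induction.
Variables (T : finType) (k M : nat).
Hypothesis k_gt1 : (1 < k)%N.
Implicit Types (A B P S : {set T}) (e d : T * T) (D E R : seq (T * T)).
Implicit Types (t q c : T -> int) (s : int).
Notation N := (dist2 k).
Let k_gt0 : (0 < k)%N. Proof. exact: ltnW. Qed.

Hypothesis IH : forall S E t q c v0, extendable k S E t q c v0 ->
  (#|S| + size E < M)%N -> realizable (2 * k%:Z) S E t.

(* A set without slack can be contracted, and then serve as a graph rooted at the
   contraction of its complement. *)
Lemma slack_or S E t q c v0 : extendable k S E t q c v0 ->
  (#|S| + size E <= M)%N -> slack k S E t q c \/ realizable (2 * k%:Z) S E t.
Proof.
move=> ext leM.
have [/forallP H|] := boolP [forall A : {set T}, (A \proper S) && (1 < #|A|)%N ==>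
    (2 * k%:Z + N (demand t c A) <= bdeg E q A)].
  by left=> A pA A1; have /implyP := H A; rewrite pA A1; apply.
rewrite negb_forall => /existsP[A]; rewrite negb_imply -ltNge => /andP[/andP[pA A1] lt].
right; have sA := proper_sub pA; have b := ext_bal ext.
have pm : perm_eq E ([seq e <- E | inside A e] ++ [seq e <- E | predC (inside A) e]).
  by rewrite perm_sym; apply/permPl; apply: perm_filterC.
have [a aA av] : exists2 a, a \in A & v0 != Some a.
  have /card_gt1P[x [y [xA yA xy]]] := A1.
  have [->|] := eqVneq v0 (Some x); last by exists x.
  by exists y => //; apply: contraNneq xy => -[->].
apply: equiv_realizable (perm_equiv pm) _.
have ext' := extendable_equiv (perm_equiv pm) ext.
have par := balanced_par k_gt0 b sA.
apply: (extendable_glue k_gt0 (ext_bal ext') sA aA (filter_all _ _) _ _ (v0 := v0)).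
- by apply/allP => e; rewrite mem_filter => /andP[].
- by move: par lt; rewrite /bdeg -(cut_perm _ pm) -/(bdeg E q A); clear; lia.
- move=> B B0 pB xB; apply: (ext_cut ext') => //; apply: proper_trans pB pA.
- by move=> x ex xA; apply: (ext_zero ext) ex (subsetP sA _ xA).
- apply: (IH (extendable_collapse k_gt0 sA aA ext' A1 av)).
  rewrite size_map -(perm_size pm).
  by apply: leq_trans leM; rewrite ltn_add2r; apply: card_collapse.
- move=> t' q' c' ext2; apply: (IH ext2).
  apply: leq_trans leM; rewrite -addSn; apply: leq_add; first exact: proper_card.
  by rewrite size_filter count_size.
Qed.

Lemma set_cases A : A != set0 -> (exists x, A = [set x]) \/ (1 < #|A|)%N.
Proof.
rewrite -card_gt0 => A0; have [A1|A1] := leqP #|A| 1; last by right.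
by left; apply/cards1P; rewrite eqn_leq A1 A0.
Qed.

(** Each end loses one edge, which the drop of its demand pays for; a larger set loses at most what
    its slack provides. *)
Lemma extendable_arc S x y E t q c s : s = 1 \/ s = -1 ->
  extendable k S ((x, y) :: E) t q c None -> slack k S ((x, y) :: E) t q c ->
  (#|S| + size ((x, y) :: E) <= M)%N -> x != y ->
  N (t x + c x - s) = N (t x + c x) - 1 -> N (t y + c y + s) = N (t y + c y) - 1 ->
  realizable (2 * k%:Z) S ((x, y) :: E) t.
Proof.
move=> hs [[h1 h2 h3 h4 h5] hz hc _] sl leM xy hx hy.
have /andP[/andP[/= xS yS] iE] := h1.
apply: (realizable_arc hs); apply: (IH (q := q) (c := c) (v0 := None));
  last by move: leM; rewrite /= addnS.
have ns : - s = 1 \/ - s = -1 by case: hs => ->; [right | left].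
split=> //.
- split=> //; first by rewrite !vsum_upd xS yS /= mulr1 mulr1 subrK.
  move=> v vS; have := h3 v vS; rewrite cut_cons /crosses !in_set1 ![_ == v]eq_sym /=.
  by case: (v == x); case: (v == y); case: hs => ->; clear; lia.
move=> A A0 pA _.
have -> : demand (fun v => t v + - s * (v == x)%:Z + s * (v == y)%:Z) c A =
   demand t c A + (- s * (x \in A)%:Z + s * (y \in A)%:Z).
  by rewrite /demand !vsum_upd; clear; lia.
have := hc A A0 pA isT; rewrite /bdeg cut_cons /crosses /=.
case: (set_cases A0) => [[v ev]|A1].
  rewrite ev demand1 !in_set1.
  have [vx|vx] := eqVneq x v; have [vy|vy] := eqVneq y v.
  - by rewrite vx vy eqxx in xy.
  - by rewrite -vx mulr1 mulr0 addr0 hx /=; clear; lia.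
  - by rewrite -vy mulr1 mulr0 add0r hy /=; clear; lia.
  by rewrite !mulr0 !addr0 /=; clear; lia.
have := sl A pA A1; rewrite /bdeg cut_cons /crosses /=.
have := dist2_sign k_gt1 (demand t c A) hs; have := dist2_sign k_gt1 (demand t c A) ns.
by case: (x \in A); case: (y \in A);
  rewrite /= ?mulr1 ?mulr0 ?addr0 ?add0r ?addNr ?addr0; clear; lia.
Qed.

Definition liftable E t q c v0 x :=
  v0 = Some x \/ 2 * k%:Z + N (t x + c x) <= bdeg E q [set x].

(** The pre-oriented root edge at [x] is continued along the edge to [y] and becomes a root edge at
    [y] of the same direction. This fixes the direction of the edge of [E], and all values
    [t v + c v] are preserved. *)
Lemma extendable_lift_root S x y E t q c v0 :
  extendable k S ((x, y) :: E) t q c v0 -> slack k S ((x, y) :: E) t q c ->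
  (#|S| + size ((x, y) :: E) <= M)%N -> x != y -> 0 < q x ->
  liftable ((x, y) :: E) t q c v0 x ->
  realizable (2 * k%:Z) S ((x, y) :: E) t.
Proof.
move=> [[h1 h2 h3 h4 h5] hz hc h0] sl leM xy qx lx.
have /andP[/andP[/= xS yS] iE] := h1.
(* The root edge used contributes [- s] to [c x]. One of that kind exists: if [c x = 0], then [q x]
   is even and positive and both kinds are present. *)
have [s hs hcx] : exists2 s : int, s = 1 \/ s = -1 & `|c x + s| <= q x - 1.
  have := h5 x xS; have := h4 x xS; have [cx|cx] := lerP (c x) 0 => h5x h4x.
    by exists 1; [left | lia].
  by exists (-1); [right | lia].
apply: (realizable_arc hs).
apply: (IH (q := fun v => q v + -1 * (v == x)%:Z + 1 * (v == y)%:Z)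
  (c := fun v => c v + s * (v == x)%:Z + - s * (v == y)%:Z) (v0 := v0));
  last by move: leM; rewrite /= addnS.
split.
- split=> //.
  + by rewrite !vsum_upd xS yS /= mulr1 mulr1 subrK.
  + move=> v vS; have := h3 v vS; rewrite cut_cons /crosses !in_set1 ![_ == v]eq_sym /=.
    by case: (v == x); case: (v == y); case: hs => ->; clear; lia.
  + move=> v vS; have := h4 v vS.
    by case: (v == x); case: (v == y); case: hs => ->; clear; lia.
  + move=> v vS; have := h5 v vS; move: hcx.
    have [->|vx] := eqVneq v x; first by rewrite (negPf xy); clear; lia.
    by case: (v == y) hs => -[->|->]; clear; lia.
- rewrite !vsum_upd xS yS.
  have -> : vsum q S + -1 * true%:Z + 1 * true%:Z = vsum q S by clear; lia.
  by have -> // : vsum c S + s * true%:Z + - s * true%:Z = vsum c S by clear; lia.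
- move=> A A0 pA xA.
  have -> : demand (fun v => t v + - s * (v == x)%:Z + s * (v == y)%:Z)
      (fun v => c v + s * (v == x)%:Z + - s * (v == y)%:Z) A = demand t c A.
    by rewrite /demand !vsum_upd; clear; lia.
  have := hc A A0 pA xA; rewrite /bdeg cut_cons /crosses /= !vsum_upd.
  case: (set_cases A0) => [[v ev]|A1].
    rewrite ev demand1 !in_set1 in xA *.
    have [vx|vx] := eqVneq x v; last by case: (y == v) => /=; clear; lia.
    case: lx xA => [ev0|]; first by rewrite ev0 /= vx eqxx.
    by rewrite vx /bdeg vsum1 cut_cons /crosses !in_set1 /= eqxx; case: (y == v) => /=; clear; lia.
  have := sl A pA A1; rewrite /bdeg cut_cons /crosses /=.
  by case: (x \in A); case: (y \in A) => /=; clear; lia.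
- by move=> v ev vS; rewrite -(h0 v ev vS); congr N; clear; lia.
Qed.

(** Among the vertices, only [x] loses degree, unless [y = z]: the new edge is then a loop and [y]
    loses two edges as well, hence the alternative. *)
Lemma extendable_lift S x y z E t q c v0 :
  extendable k S ((x, y) :: (x, z) :: E) t q c v0 ->
  slack k S ((x, y) :: (x, z) :: E) t q c ->
  (#|S| + size ((x, y) :: (x, z) :: E) <= M)%N -> x != y -> x != z ->
  liftable ((x, y) :: (x, z) :: E) t q c v0 x ->
  y != z \/ 2 * k%:Z + N (t y + c y) <= bdeg ((x, y) :: (x, z) :: E) q [set y] ->
  realizable (2 * k%:Z) S ((x, y) :: (x, z) :: E) t.
Proof.
move=> [[h1 h2 h3 h4 h5] hz hc h0] sl leM xy xz lx ly.
have /and3P[/andP[/= xS yS] /andP[/= _ zS] iE] := h1.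
apply: realizable_lift; apply: (IH (q := q) (c := c) (v0 := v0));
  last by move: leM; rewrite /= addnS.
split=> //.
- split=> //; first by rewrite /= /inside /= yS zS.
  move=> v vS; have := h3 v vS; rewrite !cut_cons /crosses !in_set1 /=.
  by case: (x == v); case: (y == v); case: (z == v) => /=; clear; lia.
move=> A A0 pA xA; have := hc A A0 pA xA; rewrite /bdeg !cut_cons /crosses /=.
case: (set_cases A0) => [[v ev]|A1].
  rewrite ev demand1 !in_set1 in xA *.
  have [vx|vx] := eqVneq x v.
    rewrite -vx [y == x]eq_sym [z == x]eq_sym (negPf xy) (negPf xz) /=.
    case: lx xA => [ev0|]; first by rewrite ev0 /= vx eqxx.
    by rewrite bdeg1 !cut_cons vsum1 /crosses !in_set1 eqxx /= [y == x]eq_sym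
      [z == x]eq_sym (negPf xy) (negPf xz) /=; clear; lia.
  case: ly => [yz|]; last first.
    rewrite bdeg1 !cut_cons /crosses !in_set1 /=; have [->|yv] := eqVneq y v.
      by rewrite (negPf vx) /= eqxx vsum1; case: (z == v) => /=; clear; lia.
    by case: (z == v) => /=; clear; lia.
  have [yv|yv] := eqVneq y v; last by case: (z == v) => /=; clear; lia.
  by rewrite -yv [z == y]eq_sym (negPf yz) /=; clear; lia.
have := sl A pA A1; rewrite /bdeg !cut_cons /crosses /=.
by case: (x \in A); case: (y \in A); case: (z \in A) => /=; clear; lia.
Qed.

Lemma extendable_lift_at S x E t q c v0 :
  extendable k S E t q c v0 -> slack k S E t q c -> (#|S| + size E <= M)%N ->
  (2 < #|S|)%N -> x \in S -> liftable E t q c v0 x ->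
  N (t x + c x) + 2 <= bdeg E q [set x] ->
  realizable (2 * k%:Z) S E t.
Proof.
move=> ext sl leM S2 xS lx dx; have b := ext_bal ext.
have sx : [set x] \subset S by rewrite sub1set.
have qx : 0 <= q x by have := bal_abs b xS; clear; lia.
have Nx := dist2_ge0 k_gt0 (t x + c x).
(* If [E] has no edge at [x], then [q x] is at least the demand at [x] plus 2, and with the bound on
   [S :\: [set x]] this exceeds the root bound. *)
have [hx|] := boolP (has (crosses [set x]) E); last first.
  rewrite has_count -leqNgt leqn0 => /eqP cx0.
  have cx : cut E [set x] = 0 by rewrite /cut cx0.
  have D1 : (1 < #|S :\: [set x]|)%N.
    by rewrite cardsD (setIidPr sx) cards1; lia.
  have pD : S :\: [set x] \proper S.
    rewrite properE subsetDl; apply/subsetPn; exists x => //.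
    by rewrite !inE eqxx.
  have D0 : S :\: [set x] != set0 by rewrite -card_gt0; lia.
  have xD : ~~ exempt v0 (S :\: [set x]).
    case: v0 {ext lx} => //= y; apply: contraTN D1 => /eqP->.
    by rewrite cards1.
  have := ext_cut ext D0 pD xD; rewrite /bdeg (cut_setD (bal_in b) sx) cx.
  have := ext_root ext; rewrite (dist2_demandS k_gt1 b) (vsum_setD q sx) vsum1.
  have -> : demand t c S = (t x + c x) + demand t c (S :\: [set x]).
    by rewrite /demand (vsum_setD t sx) (vsum_setD c sx) !vsum1; clear; lia.
  have := dist2D k_gt0 (t x + c x) (demand t c (S :\: [set x])).
  by move: dx; rewrite bdeg1 cx; clear; lia.
have [y [E1 [yx ev]]] := pick_cross hx; rewrite eq_sym in yx.
have ext1 := extendable_equiv ev ext; have sl1 := slack_equiv ev sl.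
have leM1 : (#|S| + size ((x, y) :: E1) <= M)%N by rewrite (equiv_size ev).
have bE A : bdeg ((x, y) :: E1) q A = bdeg E q A by rewrite /bdeg (equiv_cut _ ev).
have lx1 : liftable ((x, y) :: E1) t q c v0 x.
  by case: lx => [->|h]; [left | right; rewrite bE].
apply: (equiv_realizable ev).
have [q0|q0] := ltrP 0 (q x); first exact: extendable_lift_root lx1.
have {qx q0} q0 : q x = 0 by move: qx q0; clear; lia.
have yS : y \in S by have /andP[/andP[]] := bal_in (ext_bal ext1).
have finish z E2 : z != x -> equiv_edges E1 ((x, z) :: E2) ->
    y != z \/ 2 * k%:Z + N (t y + c y) <= bdeg E q [set y] ->
    realizable (2 * k%:Z) S ((x, y) :: E1) t.
  rewrite eq_sym => xz [F oF pF] hy.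
  have ev2 : equiv_edges ((x, y) :: E1) ((x, y) :: (x, z) :: E2).
    by exists ((x, y) :: F); rewrite ?perm_cons // orients_cons oF /same_ends eqxx.
  apply: (equiv_realizable ev2).
  have bE2 A : bdeg ((x, y) :: (x, z) :: E2) q A = bdeg E q A.
    by rewrite -bE /bdeg (equiv_cut _ ev2).
  apply: (extendable_lift (extendable_equiv ev2 ext1) (slack_equiv ev2 sl1)) => //.
  - by rewrite (equiv_size ev2).
  - by case: lx => [->|h]; [left | right; rewrite bE2].
  by rewrite bE2.
have [hy|hy] := lerP (2 * k%:Z + N (t y + c y)) (bdeg E q [set y]).
  have [h1|] := boolP (has (crosses [set x]) E1).
    by have [z [E2 [zx ev2]]] := pick_cross h1; apply: (finish z E2) => //; right.
  rewrite has_count -leqNgt leqn0 => /eqP cx0.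
  move: Nx dx; rewrite -bE bdeg1 cut_cons /cut cx0 q0.
  by case: (crosses _ _) => /=; clear; lia.
(* Here [y] has no degree to spare, so a neighbour of [x] other than [y] is wanted. If there is
   none, [[set x; y]] has the degree of [y] minus that of [x], too little for its slack. *)
have [h1|h1] := boolP (has (fun e => crosses [set x] e && crosses [set x; y] e) E1).
  have [z [E2 [zx hz ev2]]] := pick_cross_in h1; apply: (finish z E2) => //; left.
  by move: hz; rewrite /crosses !inE /= eqxx /= negb_or eq_sym => /andP[_]; rewrite eq_sym.
have cE : cut E1 [set x; y] = cut E1 [set y] - cut E1 [set x].
  elim: E1 h1 {ev ext1 sl1 leM1 bE lx1 finish} => [|e E1 IHE] /=; first by rewrite !cut_nil.
  rewrite negb_or !cut_cons => /andP[he /IHE->]; move: he.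
  rewrite /crosses !inE; have [->|] := eqVneq e.1 x; have [->|] := eqVneq e.2 x;
    rewrite ?(negPf yx) //=; case: (e.1 == y); case: (e.2 == y) => //=; clear; lia.
have pxy : [set x; y] \proper S.
  rewrite properEcard subUset !sub1set xS yS cards2 yx; exact: S2.
have xy1 : (1 < #|[set x; y]|)%N by rewrite cards2 yx.
have := sl1 _ pxy xy1; rewrite /bdeg cut_cons cE.
have -> : crosses [set x; y] (x, y) = false by rewrite /crosses !inE !eqxx orbT.
have sumxy f : vsum f [set x; y] = f x + f y.
  rewrite (@vsum_setD _ f [set x]) ?vsum1 ?sub1set ?inE ?eqxx //; congr (_ + _).
  rewrite -[RHS](vsum1 f); congr vsum; apply/setP => v; rewrite !inE.
  by case: eqP => //= ->; rewrite (negPf yx).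
rewrite /demand !sumxy; move: dx hy; rewrite -!bE !bdeg1 !cut_cons /crosses !in_set1 /= !eqxx.
rewrite [y == x]eq_sym (negPf yx) q0 /=.
have := dist2D k_gt0 (t x + t y + (c x + c y)) (- (t x + c x)).
rewrite dist2N // (_ : _ + - _ = t y + c y); last by clear; lia.
by clear; lia.
Qed.

(** The exemption allows lifting at [x] while its degree is at least 2. A smaller degree is [0] by
    parity with the demand, and an isolated vertex can be deleted. *)
Lemma extendable_zero S x E t q c :
  extendable k S E t q c (Some x) -> slack k S E t q c -> (#|S| + size E <= M)%N ->
  (2 < #|S|)%N -> x \in S -> all (fun e => e.1 != e.2) E ->
  realizable (2 * k%:Z) S E t.
Proof.
move=> ext sl leM S2 xS nl; have b := ext_bal ext.
have sx : [set x] \subset S by rewrite sub1set.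
have Nx : N (t x + c x) = 0 by apply: (ext_zero ext).
have aq := bal_abs b xS; have par := balanced_par k_gt0 b sx.
rewrite demand1 Nx in par; have c0 := cut_ge0 E [set x].
have [d2|d2] := lerP 2 (bdeg E q [set x]).
  have lx : liftable E t q c (Some x) x by left.
  by apply: (extendable_lift_at ext sl leM S2 xS lx); rewrite Nx add0r.
have [cx qx] : cut E [set x] = 0 /\ q x = 0 by move: par d2 aq c0; rewrite bdeg1; clear; lia.
have cx0 : c x = 0 by move: aq; rewrite qx; clear; lia.
have tx : (2 * k%:Z %| t x)%Z by rewrite -dist2_eq0 // -Nx cx0 addr0.
have pD : S :\: [set x] \proper S.
  rewrite properE subsetDl; apply/subsetPn; exists x => //.
  by rewrite !inE eqxx.
have sub A : A \subset S :\: [set x] -> A \subset S.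
  by move=> sA; apply: subset_trans sA (subsetDl _ _).
have sumD (f : T -> int) : f x = 0 -> vsum f (S :\: [set x]) = vsum f S.
  by move=> fx; rewrite (vsum_setD f sx) vsum1 fx add0r.
apply: (realizable_isolated cx tx); apply: (IH (q := q) (c := c) (v0 := None)); last first.
  apply: leq_trans leM; rewrite ltn_add2r; exact: proper_card.
split=> //.
- split.
  + exact: inside_isolated (bal_in b) nl cx.
  + have := bal_sum b; rewrite (vsum_setD t sx) vsum1 => h.
    by rewrite -(rpredDl _ tx).
  + by move=> v /(subsetP (subsetDl _ _)); apply: bal_part b _.
  + by move=> v /(subsetP (subsetDl _ _)); apply: bal_parc b _.
  + by move=> v /(subsetP (subsetDl _ _)); apply: bal_abs b _.
- by rewrite !sumD //; apply: ext_root ext.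
- move=> A A0 pA _; apply: (ext_cut ext) => //.
    by apply: proper_trans pA pD.
  rewrite /=; apply: contraTneq (proper_sub pA) => ->.
  by rewrite sub1set !inE eqxx.
Qed.

End Induction.

(** * All vertices tight: the signs of the demands *)

Section MainInduction.
Variables (T : finType) (k M : nat).
Hypothesis k_gt1 : (1 < k)%N.
Implicit Types (A B P S : {set T}) (e d : T * T) (D E R : seq (T * T)).
Implicit Types (t q c : T -> int) (s : int).
Notation N := (dist2 k).
Let k_gt0 : (0 < k)%N. Proof. exact: ltnW. Qed.

Hypothesis IH : forall S E t q c v0, extendable k S E t q c v0 ->
  (#|S| + size E < M)%N -> realizable (2 * k%:Z) S E t.

Lemma has_cross_ext S E t q c x : extendable k S E t q c None ->
  (1 < #|S|)%N -> x \in S -> has (crosses [set x]) E.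
Proof.
move=> ext S1 xS; rewrite has_count lt0n; apply/eqP => c0.
have : [set x] = S.
  apply: (connected_ext k_gt1 ext); rewrite ?sub1set // -?card_gt0 ?cards1 //.
  by rewrite /cut c0.
by move=> e; move: S1; rewrite -e cards1.
Qed.

(* Once every root edge contributes [- s] to the net degree of its end in [S], replace
   one of them, at [x], by [k - 1] edges in the other direction: modulo [k] nothing
   changes and [t] is unaffected, but the demand at [x] changes sign, so that an edge
   between [x] and a neighbour can be oriented. *)
Lemma extendable_one_sign S E t q c s : s = 1 \/ s = -1 ->
  extendable k S E t q c None -> slack k S E t q c -> (#|S| + size E <= M)%N ->
  (2 < #|S|)%N ->
  (forall x, x \in S -> [/\ N (t x + c x - s) = N (t x + c x) - 1,
     N (t x + c x + s) = N (t x + c x) + 1 &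
     bdeg E q [set x] = 2 * k%:Z - 2 + N (t x + c x)]) ->
  (forall q' c', extendable k S E t q' c' None -> vsum q' S < vsum q S ->
     realizable (2 * k%:Z) S E t) ->
  realizable (2 * k%:Z) S E t.
Proof.
move=> hs ext sl leM S2 hp IHq; have b := ext_bal ext.
have ns : - s = 1 \/ - s = -1 by case: hs => ->; [right | left].
have [/existsP[x /andP[xS cx]]|] := boolP [exists x, (x \in S) && (c x != - s * q x)].
  have xP := hp x xS.
  apply: (IHq (fun v => q v + -1 * (v == x)%:Z) (fun v => c v + - s * (v == x)%:Z));
    last by rewrite vsum_upd xS; lia.
  split=> //.
  - split; [exact: bal_in b | exact: bal_sum b | exact: bal_part b | |] => v vS.
      by have := bal_parc b vS; case: (v == x); case: hs => ->; lia.
    have := bal_parc b vS; have := bal_abs b vS; have [->|_] := eqVneq v x; last by lia.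
    by case: hs cx => ->; lia.
  - rewrite !vsum_upd xS /= !mulr1; have := ext_root ext.
    by have := dist2_sign k_gt1 (vsum c S - s) hs; rewrite subrK; lia.
  - move=> A A0 pA _; rewrite /bdeg vsum_upd.
    have -> : demand t (fun v => c v + - s * (v == x)%:Z) A = demand t c A + - s * (x \in A)%:Z.
      by rewrite /demand vsum_upd; lia.
    have := ext_cut ext A0 pA isT; rewrite /bdeg.
    have [xA|xA] := boolP (x \in A); last by rewrite !mulr0 !addr0.
    rewrite /= !mulr1; have [[v ev]|A1] := set_cases A0.
      by move: xA; rewrite ev demand1 in_set1 => /eqP<-; case: xP => -> _ _; lia.
    have := sl A pA A1; rewrite /bdeg.
    by have := dist2_sign k_gt1 (demand t c A) ns; lia.
rewrite negb_exists => /forallP hc.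
have {}hc x : x \in S -> c x = - s * q x.
  by move=> xS; have := hc x; rewrite xS negbK => /eqP.
have cS A : A \subset S -> vsum c A = - s * vsum q A.
  move=> /subsetP sA; rewrite /vsum mulr_sumr; apply: eq_bigr => v /sA; exact: hc.
have [x xS qx] : exists2 x, x \in S & 0 < q x.
  have [/existsP[x /andP[xS qx]]|] := boolP [exists x, (x \in S) && (0 < q x)].
    by exists x.
  rewrite negb_exists => /forallP h.
  have q0 x : x \in S -> q x = 0.
    move=> xS; have := h x; rewrite xS /= -leNgt; have := bal_abs b xS; lia.
  have [x xS] : exists x, x \in S by apply/set0Pn; rewrite -card_gt0; lia.
  have sx : [set x] \subset S by rewrite sub1set.
  have pD : S :\: [set x] \proper S.
    rewrite properE subsetDl; apply/subsetPn; exists x => //.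
    by rewrite !inE eqxx.
  have D1 : (1 < #|S :\: [set x]|)%N.
    by rewrite cardsD (setIidPr sx) cards1; lia.
  have := sl _ pD D1; rewrite /bdeg (cut_setD (bal_in b) sx).
  have -> : vsum q (S :\: [set x]) = 0.
    rewrite -(vsum0 (S :\: [set x])); apply: eq_vsum => v.
    by rewrite inE => /andP[_]; apply: q0.
  have [_ _] := hp x xS; rewrite bdeg1 q0 //.
  have qS : vsum q S = 0 by rewrite -(vsum0 S); apply: eq_vsum.
  have : N (demand t c S) = 0.
    by rewrite -(dist2_demandS k_gt1 b) cS // qS mulr0 dist2_small.
  have -> : demand t c S = (t x + c x) + demand t c (S :\: [set x]).
    by rewrite /demand (vsum_setD t sx) (vsum_setD c sx) !vsum1; lia.
  set u := t x + c x; set w := demand _ _ _ => h0.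
  have := dist2D k_gt0 (u + w) (- w); rewrite addrK dist2N // h0; lia.
have [p1 p2 p3] := hp x xS.
(* One root edge leaves and [k - 1] arrive, so [q] changes by [k - 2]; the net number changes by [s]
   for the former and by [s] times [k - 1] for the latter. *)
pose q' v := q v + (k%:Z - 2) * (v == x)%:Z.
pose c' v := c v + s * k%:Z * (v == x)%:Z.
have dem A : demand t c' A = demand t c A + s * k%:Z * (x \in A)%:Z.
  by rewrite /demand vsum_upd; lia.
have qS : 0 <= vsum q S by have := balanced_abs b (subxx S); lia.
have ext' : extendable k S E t q' c' None.
  split=> //.
  - split; [exact: bal_in b | exact: bal_sum b | exact: bal_part b | |] => v vS; rewrite /q' /c'.
      by have := bal_parc b vS; case: (v == x); case: hs => ->; lia.
    have := bal_parc b vS; have := bal_abs b vS; have [->|_] := eqVneq v x; last by lia.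
    by rewrite hc //; case: hs => ->; lia.
  - rewrite !vsum_upd xS /= !mulr1 cS // dist2_shift_sign // mulNr dist2N //.
    have -> : N (s * vsum q S) = N (vsum q S).
      by case: hs => ->; rewrite ?mul1r // mulN1r dist2N.
    have := ext_root ext; rewrite cS // mulNr dist2N //.
    have -> : N (s * vsum q S) = N (vsum q S).
      by case: hs => ->; rewrite ?mul1r // mulN1r dist2N.
    (* The new root bound amounts to [vsum q S + N (vsum q S) <= 2k]. With more than [2k] root
       edges, all of one direction, [N] would be at most the surplus over [2k], and the old root
       bound would fail. *)
    have := dist2_min k_gt0 (vsum q S) 1; have := dist2_le_norm k_gt0 (vsum q S).
    by rewrite mulr1; lia.
  - move=> A A0 pA _; rewrite dem /bdeg vsum_upd.
    have := ext_cut ext A0 pA isT; rewrite /bdeg.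
    have [xA|xA] := boolP (x \in A); last by rewrite !mulr0 !addr0.
    rewrite /= !mulr1 dist2_shift_sign //; have [[v ev]|A1] := set_cases A0.
      have := dist2_ge0 k_gt0 (t x + c x - s).
      by move: xA; rewrite ev demand1 in_set1 => /eqP<-; lia.
    have := sl A pA A1; rewrite /bdeg.
    by have := dist2_ge0 k_gt0 (demand t c A); lia.
have [sl'|//] := slack_or k_gt1 IH ext' leM.
have [y [E1 [yx ev]]] := pick_cross (has_cross_ext ext (ltnW S2) xS).
apply: (equiv_realizable ev).
have ext1 := extendable_equiv ev ext'.
have yS : y \in S by have /andP[/andP[]] := bal_in (ext_bal ext1).
apply: (extendable_arc k_gt1 IH ns ext1 (slack_equiv ev sl')).
- by rewrite (equiv_size ev).
- by rewrite eq_sym.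
- have -> : t x + c' x = t x + c x + s * k%:Z by rewrite /c' eqxx mulr1 addrA.
  by rewrite opprK addrAC !dist2_shift_sign // p2; clear; lia.
- by rewrite /c' (negPf yx) mulr0 addr0; case: (hp y yS).
Qed.

Lemma extendable_step S E t q c v0 : extendable k S E t q c v0 ->
  (#|S| + size E <= M)%N -> realizable (2 * k%:Z) S E t.
Proof.
(* The number of root edges is only a secondary measure: [extendable_one_sign] may add some, but
   then it removes an edge of [E] or contracts a set. *)
have [n] := ubnP `|vsum q S|; elim: n q c v0 => // n IHn q c v0 ltn ext leM.
have b := ext_bal ext.
have [nl|] := boolP (all (fun e => e.1 != e.2) E); last first.
  rewrite -has_predC => /has_perm[[x y] [E1 [/negbNE/eqP/= <- p]]].
  have ext1 := extendable_equiv (perm_equiv p) ext.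
  apply: (equiv_realizable (perm_equiv p)); apply: realizable_loop.
  apply: (IH (extendable_loop ext1)).
  by apply: leq_trans leM; rewrite (perm_size p) /= addnS.
have [S1|S1] := leqP #|S| 1.
  exists E => [|v vS]; first exact: orients_refl.
  have eS : S = [set v].
    by apply/esym/eqP; rewrite eqEcard sub1set vS cards1.
  rewrite -eS net_S ?sub0r ?rpredN ?(bal_in b) //.
  by have := bal_sum b; rewrite {1}eS vsum1.
have [S2|S2] := eqVneq #|S| 2; first exact: realizable_two ext nl S2.
have {S1 S2} S2 : (2 < #|S|)%N by rewrite ltn_neqAle eq_sym S2.
have [sl|//] := slack_or k_gt1 IH ext leM.
have zeroP x : x \in S -> extendable k S E t q c (Some x) ->
  realizable (2 * k%:Z) S E t.
  by move=> xS ext1; apply: (extendable_zero k_gt1 IH ext1).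
have [ext0|[x xS ex]] : extendable k S E t q c None \/ exists2 x, x \in S & v0 = Some x.
  case: v0 ext => [x|] ext; last by left.
  have [xS|xS] := boolP (x \in S); first by right; exists x.
  left; split=> //; first exact: ext_root ext.
  move=> A A0 pA _; apply: (ext_cut ext) => //=.
  by apply: contraNneq xS => eA; rewrite -sub1set -eA (proper_sub pA).
(* Any vertex of demand [0] may be declared exempt and lifted away. *)
- have [/existsP[x /andP[xS /eqP Nx]]|] :=
      boolP [exists x, (x \in S) && (N (t x + c x) == 0)].
    apply: (zeroP x xS); split=> //; first exact: ext_root ext.
      by move=> A A0 pA _; apply: (ext_cut ext0).
    by move=> _ [<-].
  rewrite negb_exists => /forallP Nn0.
  have {}Nn0 x : x \in S -> N (t x + c x) != 0.
    by move=> xS; have := Nn0 x; rewrite xS.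
  have [/existsP[x /andP[xS dx]]|] :=
      boolP [exists x, (x \in S) && (2 * k%:Z + N (t x + c x) <= bdeg E q [set x])].
    have lx : liftable k E t q c None x by right.
    apply: (extendable_lift_at k_gt1 IH ext0 sl leM S2 xS lx).
    by move: dx k_gt0; clear; lia.
  rewrite negb_exists => /forallP dS.
  have {}dS x : x \in S -> bdeg E q [set x] = 2 * k%:Z - 2 + N (t x + c x).
    move=> xS; have := dS x; rewrite xS /= -ltNge.
    have sx : [set x] \subset S by rewrite sub1set.
    have x0 : [set x] != set0 by rewrite -card_gt0 cards1.
    have px : [set x] \proper S by rewrite properEcard sx cards1 ltnW.
    have := ext_cut ext0 x0 px isT; have := balanced_par k_gt0 b sx.
    by rewrite demand1; lia.
  (* At a [pos] vertex an outgoing arc lowers the demand, at a [neg] vertex an incoming one. An edge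
     with a [pos] end and a [neg] end can be oriented at once; if there is none, connectedness gives
     all vertices the same single sign. *)
  pose pos x := N (t x + c x - 1) == N (t x + c x) - 1.
  pose neg x := N (t x + c x + 1) == N (t x + c x) - 1.
  have [/has_perm[[x y] [E1 [/= xy p]]]|none] :=
      boolP (has (fun e => (pos e.1 && neg e.2) || (pos e.2 && neg e.1)) E).
    have ev := perm_equiv p; apply: (equiv_realizable ev).
    have exy : x != y by have := allP nl (x, y); rewrite (perm_mem p) mem_head => /(_ isT).
    have ext1 := extendable_equiv ev ext0; have sl1 := slack_equiv ev sl.
    have leM1 : (#|S| + size ((x, y) :: E1) <= M)%N by rewrite (equiv_size ev).
    case/orP: xy => /andP[/eqP p1 /eqP p2].
      by apply: (extendable_arc k_gt1 IH (or_introl (erefl 1)) ext1).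
    have e1 : (-1)%R = 1%R :> int \/ (-1)%R = (-1)%R :> int by right.
    by apply: (extendable_arc k_gt1 IH e1 ext1) => //; rewrite opprK.
  have pn x : x \in S -> pos x || neg x.
    by move=> /Nn0 /(dist2_pos_neg k_gt0); rewrite /pos /neg => -[->|->]; rewrite eqxx ?orbT.
  have cut0 (p : pred T) : (forall e, e \in E -> p e.1 = p e.2) ->
      cut E [set x in S | p x] = 0.
    move=> pE; rewrite /cut (_ : count _ _ = 0)%N //; apply/eqP.
    rewrite -leqn0 leqNgt -has_count; apply/hasPn => e eE.
    have /andP[e1 e2] := allP (bal_in b) e eE.
    by rewrite /crosses !inE e1 e2 pE // addbb.
  have agree e : e \in E -> (pos e.1 = pos e.2) /\ (neg e.1 = neg e.2).
    move=> eE; have /andP[/pn e1 /pn e2] := allP (bal_in b) e eE.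
    have := hasPn none e eE; move: e1 e2.
    by case: (pos e.1); case: (neg e.1); case: (pos e.2); case: (neg e.2).
  have full (p : pred T) : (forall e, e \in E -> p e.1 = p e.2) ->
      (exists2 x, x \in S & p x) -> forall x, x \in S -> p x.
    move=> pE [y yS py] x xS.
    have eS : [set x in S | p x] = S.
      apply: (connected_ext k_gt1 ext0); last exact: cut0.
        by apply/subsetP => v; rewrite inE => /andP[].
      by apply/set0Pn; exists y; rewrite inE yS.
    by move: xS; rewrite -{1}eS inE => /andP[].
  have fullP := full pos (fun e eE => proj1 (agree e eE)).
  have fullN := full neg (fun e eE => proj2 (agree e eE)).
  have [z zS] : exists z, z \in S by apply/set0Pn; rewrite -card_gt0; lia.
  have notboth x : x \in S -> ~~ (pos x && neg x).
    move=> xS; apply/negP => /andP[px nx].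
    have : has (crosses [set x]) E by apply: has_cross_ext ext0 _ xS; lia.
    move=> /hasP[e eE _]; have /andP[e1 e2] := allP (bal_in b) e eE.
    have := hasPn none e eE; rewrite (fullP (ex_intro2 _ _ x xS px)) //.
    by rewrite (fullN (ex_intro2 _ _ x xS nx)).
  have IHq q' c' : extendable k S E t q' c' None -> vsum q' S < vsum q S ->
      realizable (2 * k%:Z) S E t.
    move=> ext' lq; apply: (IHn q' c' None _ ext' leM).
    have := balanced_abs (ext_bal ext') (subxx S); lia.
  case/orP: (pn z zS) => hz.
    have P := fullP (ex_intro2 _ _ z zS hz).
    apply: (extendable_one_sign (or_introl (erefl 1)) ext0 sl leM S2 _ IHq) => x xS.
    split; [exact/eqP/P | | exact: dS].
    have := notboth x xS; rewrite P //= /neg; case: (dist2S k_gt0 (t x + c x)) => -> //.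
    by rewrite eqxx.
  have P := fullN (ex_intro2 _ _ z zS hz).
  have e1 : (-1)%R = 1%R :> int \/ (-1)%R = (-1)%R :> int by right.
  apply: (extendable_one_sign e1 ext0 sl leM S2 _ IHq) => x xS.
  split; [by rewrite opprK; exact/eqP/P | | exact: dS].
  have := notboth x xS; rewrite P //= andbT /pos; case: (dist2B1 k_gt0 (t x + c x)) => -> //.
  by rewrite eqxx.
by apply: (zeroP x xS); rewrite -ex.
Qed.

End MainInduction.

Theorem extendable_realizable (T : finType) (k : nat) (S : {set T}) (E : seq (T * T))
    (t q c : T -> int) (v0 : option T) :
  (1 < k)%N -> extendable k S E t q c v0 -> realizable (2 * k%:Z) S E t.
Proof.
move=> k1; have [M] := ubnP (#|S| + size E).
elim: M S E t q c v0 => // M IHM S E t q c v0 ltM ext.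
apply: (extendable_step k1 _ ext (M := M)) => // S' E' t' q' c' w ext' lt'.
exact: IHM lt' ext'.
Qed.

(** * Odd-edge-connected graphs *)

(** The case of an empty root, stated through [balanced] so that its lemmas on contraction and
    equivalence apply. *)
Definition consistent (T : finType) (k : nat) (S : {set T}) (E : seq (T * T))
    (t : T -> int) : Prop :=
  balanced k S E t (fun=> 0) (fun=> 0).

Section Rootless.
Variables (T : finType) (k : nat).
Hypothesis k_gt1 : (1 < k)%N.
Implicit Types (A B P S X Y : {set T}) (e d : T * T) (D E R : seq (T * T)).
Implicit Types (t : T -> int).
Notation N := (dist2 k).
Let k_gt0 : (0 < k)%N. Proof. exact: ltnW. Qed.

Lemma consistentP S E t : all (inside S) E -> (2 * k%:Z %| vsum t S)%Z ->
  (forall v, v \in S -> (2 %| t v - cut E [set v])%Z) -> consistent k S E t.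
Proof. by split=> // v vS; rewrite ?subrr // normr0. Qed.

Lemma consistent_equiv S E E' t : equiv_edges E E' ->
  consistent k S E t -> consistent k S E' t.
Proof. exact: balanced_equiv. Qed.

Lemma consistent_collapse S A a E t : A \subset S -> a \in A -> consistent k S E t ->
  consistent k (a |: (S :\: A)) (map (collapse_edge A a) E)
    (fun v => if v == a then vsum t A else t v).
Proof.
by move=> sA aA b; have [h1 h2 h3 _ _] := balanced_collapse k_gt0 sA aA b; apply: consistentP.
Qed.

Lemma consistent_loop S x E t : consistent k S ((x, x) :: E) t -> consistent k S E t.
Proof.
move=> [h1 h2 h3 _ _]; apply: consistentP => //; first by case/andP: h1.
by move=> v /h3; rewrite cut_cons /crosses addbb add0r.
Qed.

Lemma consistent_lift S x y z E t :
  consistent k S ((x, y) :: (x, z) :: E) t -> consistent k S ((y, z) :: E) t.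
Proof.
move=> [/and3P[/andP[/= xS yS] /andP[/= _ zS] iE] h2 h3 _ _]; apply: consistentP => //.
  by rewrite /= /inside /= yS zS.
move=> v /h3; rewrite !cut_cons /crosses !in_set1 /=.
by case: (x == v); case: (y == v); case: (z == v) => /=; clear; lia.
Qed.

(* A minimal set violating the cut condition is contracted first; it then meets
   the hypotheses of [extendable_realizable] with its complement as root. *)
Lemma realizable_min S E t : consistent k S E t ->
  (forall A a, A \proper S -> (1 < #|A|)%N -> a \in A ->
     realizable (2 * k%:Z) (a |: (S :\: A)) (map (collapse_edge A a) E)
       (fun v => if v == a then vsum t A else t v)) ->
  (forall x, x \in S -> (1 < #|S|)%N -> cut E [set x] < 2 * k%:Z - 2 + N (t x) ->
     realizable (2 * k%:Z) S E t) ->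
  realizable (2 * k%:Z) S E t.
Proof.
move=> b hcol h1.
have z0 A : vsum (fun=> 0 : int) A = 0 by apply: vsum0.
pose bad A := [&& A != set0, A \proper S & cut E A < 2 * k%:Z - 2 + N (vsum t A)].
have bdegE A : bdeg E (fun=> 0) A = cut E A by rewrite /bdeg z0 addr0.
have demE A : demand t (fun=> 0) A = vsum t A by rewrite /demand z0 addr0.
have [/existsP[A0 badA0]|] := boolP [exists A, bad A]; last first.
  rewrite negb_exists => /forallP H.
  apply: (@extendable_realizable _ _ _ _ _ (fun=> 0) (fun=> 0) None) => //; split=> //.
    by rewrite !z0; move: (dist2_ge0 k_gt0 0) k_gt1; clear; lia.
  move=> A hA pA _; have := H A.
  by rewrite /bad hA pA /= -leNgt bdegE demE.
have [A /minsetP[badA minA] _] := minset_exists badA0.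
have /and3P[A0' pA ltA] := badA; have sA := proper_sub pA.
have [[x ex]|A1] := set_cases A0'.
  apply: (h1 x); first by rewrite -sub1set -ex.
    by have := proper_card pA; rewrite ex cards1.
  by move: ltA; rewrite ex vsum1.
have [a aA] := set0Pn _ A0'.
have pm : perm_eq E ([seq e <- E | inside A e] ++ [seq e <- E | predC (inside A) e]).
  by rewrite perm_sym; apply/permPl; apply: perm_filterC.
apply: equiv_realizable (perm_equiv pm) _.
apply: (extendable_glue k_gt0 (balanced_equiv (perm_equiv pm) b) sA aA
  (filter_all _ _) _ _ (v0 := None)).
- by apply/allP => e; rewrite mem_filter => /andP[].
- rewrite /bdeg -(cut_perm _ pm) -/(bdeg E _ A) bdegE demE.
  have := balanced_par k_gt0 b sA; rewrite bdegE demE; move: ltA; clear; lia.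
- move=> B B0 pB _; rewrite /bdeg -(cut_perm _ pm) -/(bdeg E _ B) bdegE demE leNgt.
  apply/negP => ltB; have : bad B by rewrite /bad B0 (proper_trans pB pA).
  by move=> /minA/(_ (proper_sub pB)) e; move: pB; rewrite e properxx.
- by [].
- apply: realizable_perm (hcol A a pA A1 aA); exact: perm_map.
- by move=> t' q' c'; apply: extendable_realizable.
Qed.

Lemma cut_uncross E X Y :
  [/\ cut E (X :&: Y) + cut E (X :|: Y) <= cut E X + cut E Y,
      (2 %| cut E (X :&: Y) + cut E (X :|: Y) - (cut E X + cut E Y))%Z,
      cut E (X :\: Y) + cut E (Y :\: X) <= cut E X + cut E Y &
      (2 %| cut E (X :\: Y) - (cut E X + cut E (X :&: Y)))%Z].
Proof.
elim: E => [|e E [h1 h2 h3 h4]]; first by rewrite !cut_nil.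
rewrite !cut_cons /crosses !inE; move: h1 h2 h3 h4.
case: (e.1 \in X); case: (e.1 \in Y); case: (e.2 \in X); case: (e.2 \in Y) => /=;
  by clear => *; split; lia.
Qed.

Definition odd_cuts S E := forall A, A \subset S -> ~~ (2 %| cut E A)%Z ->
  3 * k%:Z - 2 <= cut E A.

(* Zhang's argument: lift an edge towards a maximal tight set [X] with an edge leaving
   [X]; a tight set blocking this could be uncrossed with [X]. *)
Lemma splittable_pair S x E : odd k -> all (inside S) E -> odd_cuts S E ->
  x \in S -> (2 %| cut E [set x])%Z -> cut E [set x] != 0 ->
  exists a b E2, [/\ x != a, x != b, equiv_edges E ((x, a) :: (x, b) :: E2) &
    odd_cuts S ((a, b) :: E2)].
Proof.
move=> oddk iE oc xS evx nzx.
have hx : has (crosses [set x]) E.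
  by rewrite has_count lt0n; apply: contra nzx => /eqP c0; rewrite /cut c0.
have [a [E1 [ax ev]]] := pick_cross hx; rewrite eq_sym in ax.
have cE A : cut E A = cut ((x, a) :: E1) A by rewrite (equiv_cut _ ev).
pose tight A := [&& A \subset S, x \notin A, a \in A & cut E A == 3 * k%:Z - 2].
have odd3 : ~~ (2 %| 3 * k%:Z - 2)%Z by move: oddk; clear; lia.
have iE1 : all (inside S) ((x, a) :: E1) by rewrite (equiv_inside _ ev).
have aS : a \in S by have /andP[/andP[]] := iE1.
(* Lifting [xa] and [xb] only hurts sets that separate [x] from both [a] and [b], by two edges; as
   [3k - 2] is odd, such a set must have exactly [3k - 2] edges. If it contains [x], its complement
   in [S] is [tight]. *)
have finish b E2 : b != x -> equiv_edges E1 ((x, b) :: E2) ->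
   (forall A, tight A -> b \notin A) ->
   exists a b E2, [/\ x != a, x != b, equiv_edges E ((x, a) :: (x, b) :: E2) &
    odd_cuts S ((a, b) :: E2)].
  rewrite eq_sym => bx [F oF pF] hb; exists a, b, E2.
  have ev2 : equiv_edges ((x, a) :: E1) ((x, a) :: (x, b) :: E2).
    by exists ((x, a) :: F); rewrite ?perm_cons // orients_cons oF /same_ends eqxx.
  have cE2 A : cut E A = cut ((x, a) :: (x, b) :: E2) A by rewrite cE (equiv_cut _ ev2).
  have bS : b \in S.
    have : all (inside S) ((x, a) :: (x, b) :: E2) by rewrite (equiv_inside _ ev2).
    by case/and3P=> _ /andP[].
  split=> //.
    have [G oG pG] := ev; rewrite perm_sym in pG.
    have [F' oF' pF'] := ev2; have [G' oG' pG'] := orients_perm oF' pG.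
    exists G'; first exact: orients_trans oG' oG.
    by rewrite -(permPl pG').
  move=> A sA; rewrite cut_cons => oA; rewrite leNgt; apply/negP => ltA.
  have oE : ~~ (2 %| cut E A)%Z.
    move: oA; rewrite cE2 !cut_cons /crosses /=; clear.
    by case: (x \in A); case: (a \in A); case: (b \in A) => /=; lia.
  have := oc A sA oE => geA.
  have [xA aA bA cA] : [/\ (x \in A) != (a \in A), (b \in A) = (a \in A), true &
      cut E A = 3 * k%:Z - 2].
    move: ltA geA oE odd3; rewrite cE2 !cut_cons /crosses /=; clear.
    by case: (x \in A); case: (a \in A); case: (b \in A) => /=; split=> //; lia.
  have [xinA|xnA] := boolP (x \in A).
    have aNA : a \notin A by move: xA; rewrite xinA; case: (a \in A).
    have tY : tight (S :\: A).
      rewrite /tight subsetDl !inE xinA aNA aS /=; apply/eqP.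
      by rewrite cut_setD.
    by have := hb _ tY; rewrite !inE bS andbT aA aNA.
  have ainA : a \in A by move: xA; rewrite (negPf xnA); case: (a \in A).
  have tY : tight A by rewrite /tight sA xnA ainA cA eqxx.
  by have := hb _ tY; rewrite aA ainA.
have [/existsP[X0 tX0]|] := boolP [exists A, tight A]; last first.
  rewrite negb_exists => /forallP nt.
  have [h1|] := boolP (has (crosses [set x]) E1).
    have [b [E2 [bx ev2]]] := pick_cross h1; apply: (finish b E2 bx ev2) => A tA.
    by have := nt A; rewrite tA.
  rewrite has_count -leqNgt leqn0 => /eqP c0.
  move: evx nzx; rewrite cE cut_cons /cut c0; clear.
  by case: (crosses _ _).
have [X /maxsetP[tX maxX] _] := maxset_exists tX0.
have /and4P[sX xX aX /eqP cX] := tX.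
(* If every edge at [x] goes to [X], adding [x] to [X] subtracts the even positive degree of [x]
   from [3k - 2], giving an odd cut that is too small. *)
have [h1|h1] := boolP (has (fun e => crosses [set x] e && crosses (x |: X) e) E1); last first.
  have eq1 : cut E1 (x |: X) = cut E1 X - cut E1 [set x].
    elim: E1 h1 {ev cE iE1 finish} => [|e E1 IH] /=; first by rewrite !cut_nil.
    rewrite negb_or !cut_cons => /andP[he /IH->]; move: he.
    rewrite /crosses !inE; have [->|n1] := eqVneq e.1 x; have [->|n2] := eqVneq e.2 x;
      rewrite ?(negPf xX) //=; case: (_ \in X); rewrite ?(negPf xX) //=;
      try (case: (_ \in X)); rewrite //=; clear; lia.
  have eq2 : cut E (x |: X) = cut E X - cut E [set x].
    rewrite !cE !cut_cons eq1 /crosses !inE eqxx aX [a == x]eq_sym (negPf ax) (negPf xX) /=.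
    by clear; lia.
  have sxX : x |: X \subset S by rewrite subUset sub1set xS.
  have o1 : ~~ (2 %| cut E (x |: X))%Z.
    by rewrite eq2 cX; move: evx odd3; clear; lia.
  have := oc _ sxX o1; rewrite eq2 cX; have := cut_ge0 E [set x].
  by move: nzx; clear; lia.
have [b [E2 [bx hb ev2]]] := pick_cross_in h1; apply: (finish b E2 bx ev2) => Y tY.
have bX : b \notin X.
  by move: hb; rewrite /crosses !inE eqxx /= negb_or => /andP[].
apply/negP => bY; have /and4P[sY xY aY /eqP cY] := tY.
have [u1 u2 _ u4] := cut_uncross E X Y.
have [_ _ u5 u6] := cut_uncross E Y X.
have sI : X :&: Y \subset S by apply: subset_trans (subsetIl _ _) sX.
have sU : X :|: Y \subset S by rewrite subUset sX.
(* If the union has an even cut, both differences have odd cuts. The edge [xa] is counted for [X]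
   and for [Y] but for neither difference, so their sizes sum to at most [2(3k - 2) - 2], too few.
   Otherwise the union is tight and contradicts the maximality of [X], since [b] lies outside
   [X]. *)
have [oU|oU] := boolP (2 %| cut E (X :|: Y))%Z.
  have oXY : ~~ (2 %| cut E (X :\: Y))%Z.
    by move: u2 u4 oU odd3; rewrite cX cY; clear; lia.
  have oYX : ~~ (2 %| cut E (Y :\: X))%Z.
    by move: u2 u6 oU odd3; rewrite setIC cX cY; clear; lia.
  have g1 := oc _ (subset_trans (subsetDl X Y) sX) oXY.
  have g2 := oc _ (subset_trans (subsetDl Y X) sY) oYX.
  have [_ _ u7 _] := cut_uncross E1 X Y; move: g1 g2 cX cY u7; rewrite !cE !cut_cons.
  rewrite /crosses !inE (negPf xX) (negPf xY) aX aY /=; clear; lia.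
have oI : ~~ (2 %| cut E (X :&: Y))%Z.
  by move: u2 oU odd3; rewrite cX cY; clear; lia.
have gI := oc _ sI oI; have gU := oc _ sU oU.
have tU : tight (X :|: Y).
  rewrite /tight sU !inE negb_or xX xY aX /=; apply/eqP.
  by move: u1 gI gU; rewrite cX cY; clear; lia.
have eU := maxX _ tU (subsetUl X Y).
by move: bX; rewrite -eU inE bY orbT.
Qed.

Theorem odd_cuts_realizable S E t : odd k -> consistent k S E t ->
  (forall v, v \in S -> (k%:Z %| t v)%Z) -> odd_cuts S E ->
  realizable (2 * k%:Z) S E t.
Proof.
move=> oddk; have [M] := ubnP (#|S| + size E).
elim: M S E t => // M IHM S E t ltM b kt oc.
have [nl|] := boolP (all (fun e => e.1 != e.2) E); last first.
  rewrite -has_predC => /has_perm[[x y] [E1 [/negbNE/eqP/= <- p]]].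
  have b1 := consistent_equiv (perm_equiv p) b.
  apply: (equiv_realizable (perm_equiv p)); apply: realizable_loop.
  apply: IHM (consistent_loop b1) kt _.
    by move: ltM; rewrite (perm_size p) /= addnS.
  move=> A sA; have := oc A sA; rewrite (cut_perm _ p) cut_cons.
  by rewrite /crosses addbb add0r.
have [/existsP[x /and3P[xS evx nzx]]|] := boolP [exists x, [&& x \in S,
    (2 %| cut E [set x])%Z & cut E [set x] != 0]].
  have [a [b' [E2 [xa xb ev oc2]]]] := splittable_pair oddk (bal_in b) oc xS evx nzx.
  apply: (equiv_realizable ev); apply: realizable_lift.
  apply: IHM => //; last exact: consistent_lift (consistent_equiv ev b).
  by move: ltM; rewrite -(equiv_size ev) /= !addnS !ltnS.
rewrite negb_exists => /forallP allodd.
have [/existsP[x /andP[xS /eqP cx]]|] := boolP [exists x, (x \in S) && (cut E [set x] == 0)].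
  have tx : (2 * k%:Z %| t x)%Z.
    have := bal_part b xS; rewrite cx subr0; have /dvdzP[j ->] := kt x xS => h.
    have ek : k%:Z = 2 * (k./2)%:Z + 1 by rewrite -[in LHS](odd_double_half k) oddk; clear; lia.
    have /dvdzP[i ->] : (2 %| j)%Z.
      by move: h; rewrite ek mulrDr mulr1 mulrCA rpredDl // dvdz_mulr.
    by apply/dvdzP; exists i; clear; lia.
  have sx : [set x] \subset S by rewrite sub1set.
  apply: (realizable_isolated cx tx); apply: IHM.
  - rewrite -ltnS; apply: leq_ltn_trans ltM; rewrite -addSn leq_add2r.
    by apply: proper_card; rewrite properE subsetDl; apply/subsetPn; exists x; rewrite // !inE eqxx.
  - apply: consistentP; first exact: inside_isolated (bal_in b) nl cx.
      by have := bal_sum b; rewrite (vsum_setD t sx) vsum1 rpredDl.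
    by move=> v /setDP[vS _]; exact: (bal_part b vS).
  - by move=> v /setDP[vS _]; apply: kt.
  - by move=> A sA; apply: oc; apply: subset_trans sA (subsetDl _ _).
rewrite negb_exists => /forallP nz.
apply: realizable_min => //.
- move=> A a pA A1 aA; have sA := proper_sub pA; apply: IHM.
  + rewrite -ltnS; apply: leq_ltn_trans ltM; rewrite size_map -addSn leq_add2r.
    exact: card_collapse.
  + exact: consistent_collapse.
  + move=> v; rewrite !inE; case: eqP => [_ _|_ /= /andP[_ vS]]; last exact: kt.
    by apply: rpred_sum => u uA; apply: kt; apply: subsetP uA.
  + by move=> B sB; rewrite cut_collapse; apply: oc; apply: collapse_sub.
(* Only odd vertices are left, and their degree is at least [3k - 2], which covers [2k - 2] plus the
   largest value [k] of [dist2]. *)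
- move=> x xS S1 lt; have := allodd x; have := nz x; rewrite xS /= => n0; rewrite n0 andbT => o1.
  have := oc [set x]; rewrite sub1set xS => /(_ isT o1).
  by have := dist2_lek k_gt0 (t x); move: lt; clear; lia.
Qed.

End Rootless.

(** * Tree-connected graphs *)

(** Connectedness in terms of cuts, a form that passes directly to contractions and is easy to test
    after a lift. *)
Definition cut_connected (T : finType) (S : {set T}) (L : seq (T * T)) : bool :=
  all (inside S) L &&
  [forall A : {set T}, (A != set0) && (A \proper S) ==> (0 < cut L A)].

Section Trees.
Variables (T : finType) (k : nat).
Hypothesis k_gt1 : (1 < k)%N.
Implicit Types (A B P S X Y : {set T}) (e d : T * T) (D E R L : seq (T * T)).
Implicit Types (t : T -> int) (U F Ls : seq (seq (T * T))).
Notation N := (dist2 k).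
Let k_gt0 : (0 < k)%N. Proof. exact: ltnW. Qed.

Lemma cut_connectedP S L : reflect
  (all (inside S) L /\ forall A, A != set0 -> A \proper S -> 0 < cut L A)
  (cut_connected S L).
Proof.
apply: (iffP andP) => -[iL H]; split=> //.
  by move=> A A0 pA; have /forallP/(_ A) := H; rewrite A0 pA.
by apply/forallP => A; apply/implyP => /andP[A0 pA]; apply: H.
Qed.

Lemma equiv_flatten U U' : perm_eq U U' -> equiv_edges (flatten U) (flatten U').
Proof. by move=> p; apply: perm_equiv; apply: perm_flatten. Qed.

Lemma connected_equiv S L L' : equiv_edges L L' -> cut_connected S L -> cut_connected S L'.
Proof.
move=> ev /cut_connectedP[iL H]; apply/cut_connectedP; split.
  by rewrite (equiv_inside _ ev).
by move=> A A0 pA; rewrite (equiv_cut _ ev); apply: H.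
Qed.

(** A set separating [L] separates the larger list too, after adding [x] to it in case it contains
    [a]. *)
Lemma connected_leaf S x a L : x \in S ->
  all (inside (S :\: [set x])) L ->
  cut_connected S ((x, a) :: L) -> cut_connected (S :\: [set x]) L.
Proof.
move=> xS iD /cut_connectedP[_ H]; apply/cut_connectedP; split=> // A A0 pA.
have xA : x \notin A by apply/negP => /(subsetP (proper_sub pA)); rewrite !inE eqxx.
have sA : A \subset S by apply: subset_trans (proper_sub pA) (subsetDl _ _).
have [aA|aA] := boolP (a \in A); last first.
  have := H A A0; rewrite cut_cons /crosses /= (negPf xA) (negPf aA) add0r; apply.
  by apply: proper_sub_trans pA (subsetDl _ _).
have -> : cut L A = cut L (x |: A).
  rewrite -(cut_inside (x |: A) iD); congr cut; apply/setP => v; rewrite !inE.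
  case: eqP => [->|_] /=; first by rewrite (negPf xA).
  by rewrite andb_idr // => /(subsetP sA).
have := H (x |: A); rewrite cut_cons /crosses !inE eqxx aA orbT add0r; apply.
  by apply/set0Pn; exists x; rewrite !inE eqxx.
have /properP[_ [v]] := pA; rewrite !inE => /andP[vx vS] vA.
rewrite properE subUset sub1set xS sA /=; apply/subsetPn; exists v => //.
by rewrite !inE negb_or vx.
Qed.

(* If both fail, the union of the two separating sets containing [x] also separates the
   original list, since it avoids [b]. *)
Lemma connected_swap S x a1 a2 b L : x \in S -> b \in S ->
  cut_connected S ((x, a1) :: (x, a2) :: L) ->
  cut_connected S ((b, a1) :: (x, a2) :: L) \/
  cut_connected S ((b, a2) :: (x, a1) :: L).
Proof.
move=> xS bS /cut_connectedP[iL H].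
have /and3P[/andP[/= _ a1S] /andP[/= _ a2S] iL0] := iL.
pose bad (c c' : T) A := [/\ A \proper S, x \in A, c' \in A &
  [/\ c \notin A, b \notin A & cut L A = 0]].
have step c c' : c \in S -> c' \in S ->
    (forall A, A != set0 -> A \proper S -> 0 < cut ((x, c) :: (x, c') :: L) A) ->
    cut_connected S ((b, c) :: (x, c') :: L) \/ exists A, bad c c' A.
  move=> cS c'S Hc.
  have [|nc] := boolP (cut_connected S ((b, c) :: (x, c') :: L)); [by left | right].
  have iN : all (inside S) ((b, c) :: (x, c') :: L) by rewrite /= /inside /= bS cS xS c'S.
  have [A [A0 pA cA xA]] : exists A, [/\ A != set0, A \proper S,
      cut ((b, c) :: (x, c') :: L) A = 0 & x \in A].
    move: nc; rewrite /cut_connected iN negb_forall => /existsP[A].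
    rewrite negb_imply -leNgt => /andP[/andP[A0 pA] cA].
    have {}cA : cut ((b, c) :: (x, c') :: L) A = 0.
      by have := cut_ge0 ((b, c) :: (x, c') :: L) A; move: cA; clear; lia.
    have [xA|xA] := boolP (x \in A); first by exists A.
    exists (S :\: A); split.
    - by rewrite setD_eq0; case/andP: pA.
    - have [v vA] := set0Pn _ A0; rewrite properE subsetDl; apply/subsetPn; exists v.
        by apply: subsetP (proper_sub pA) _ vA.
      by rewrite inE vA.
    - by rewrite cut_setD // proper_sub.
    by rewrite inE xA.
  have hA := Hc A A0 pA; exists A; move: cA hA; rewrite !cut_cons /crosses /= xA /=.
  have := cut_ge0 L A; rewrite /bad pA xA.
  by case: (b \in A); case: (c \in A); case: (c' \in A) => //= h1 h2 h3;
    do ?split=> //; move: h1 h2 h3; clear; lia.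
have [|[A [pA xA a2A [a1A bA cA]]]] := step a1 a2 a1S a2S H; first by left.
have H' : forall A, A != set0 -> A \proper S -> 0 < cut ((x, a2) :: (x, a1) :: L) A.
  by move=> B B0 pB; have := H B B0 pB; rewrite !cut_cons; clear; lia.
have [|[B [pB xB a1B [a2B bB cB]]]] := step a2 a1 a2S a1S H'; first by right.
have pU : A :|: B \proper S.
  rewrite properE subUset (proper_sub pA) (proper_sub pB) /=; apply/subsetPn; exists b => //.
  by rewrite inE negb_or bA.
have U0 : A :|: B != set0 by apply/set0Pn; exists x; rewrite inE xA.
have := H _ U0 pU; rewrite !cut_cons /crosses !inE xA a1B a2A orbT /=.
have [u _ _ _] := cut_uncross L A B; have := cut_ge0 L (A :&: B).
by move: u; rewrite cA cB; clear; lia.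
Qed.

(** For edges within [S], this excludes precisely the loops at [x]. *)
Definition at_or_inside (S : {set T}) x e :=
  crosses [set x] e || inside (S :\: [set x]) e.

(** * Removing a vertex of small degree while keeping [2k - 2] connected lists *)

Section Vertex.
Variables (S : {set T}) (x : T).
Hypothesis xS : x \in S.
Hypothesis IH : forall Ls t, size Ls = (2 * k - 2)%N ->
  all (cut_connected (S :\: [set x])) Ls -> consistent k (S :\: [set x]) (flatten Ls) t ->
  realizable (2 * k%:Z) (S :\: [set x]) (flatten Ls) t.

Lemma realizable_star F (B : seq (T * T)) t : size F = (2 * k - 2)%N ->
  all (cut_connected (S :\: [set x])) F -> all (crosses [set x]) B ->
  (k - 1 <= size B)%N -> consistent k S (B ++ flatten F) t ->
  realizable (2 * k%:Z) S (B ++ flatten F) t.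
Proof.
move=> sF cF cB sB b; have sx : [set x] \subset S by rewrite sub1set.
have iF : all (inside (S :\: [set x])) (flatten F).
  elim: F cF {sF b} => //= L F IHF /andP[/cut_connectedP[iL _] /IHF iF].
  by rewrite all_cat iL iF.
have iB : all (inside S) B by have := bal_in b; rewrite all_cat => /andP[].
have cBx : cut B [set x] = (size B)%:Z by rewrite /cut; move: cB; rewrite all_count => /eqP->.
have off D : all (inside (S :\: [set x])) D -> cut D [set x] = 0.
  move=> iD; rewrite -(cut_inside [set x] iD) (_ : _ :&: _ = set0).
    by rewrite /cut (eq_count (a2 := pred0)) ?count_pred0 // => e; rewrite /crosses !inE.
  by apply/setP => v; rewrite !inE; case: eqP.
have par := bal_part b xS; rewrite cut_cat cBx off // addr0 in par.
(* The edges of [B] alone meet the prescription at [x]: [s] has norm at most [k] and the parity of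
   [size B], so [k - 1] edges are enough. What they contribute elsewhere is subtracted from [t]. *)
have [j [s [ej es sk]]] := dist2_spec k_gt0 (t x).
have hs1 : `|s| <= (size B)%:Z.
  by have := dist2_lek k_gt0 (t x); move: es sB par ej k_gt1; clear; lia.
have hs2 : (2 %| s - (size B)%:Z)%Z by move: par ej; clear; lia.
have [DB oB nB] := orient_bundle cB hs1 hs2.
have nBS : net DB S = 0 by apply: net_S; rewrite (orients_inside _ oB).
have [|D oD HD] := IH (t := fun v => t v - net DB [set v]) sF cF.
  apply: consistentP => //.
    have := bal_sum b; move: nBS; rewrite net_sum !(vsum_setD _ sx) !vsum1 nB vsumB ej.
    move=> h /dvdzP[i ei]; apply/dvdzP; exists (i - j).
    by move: h ei; clear; lia.
  move=> v /setDP[vS _]; have := bal_part b vS; rewrite cut_cat.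
  by have [_] := net_orients [set v] oB; clear; lia.
exists (DB ++ D); first exact: orients_cat.
move=> v vS; rewrite net_cat; have [->|vx] := eqVneq v x.
  have [h _] := net_orients [set x] oD; rewrite off // in h.
  by rewrite nB; apply/dvdzP; exists (- j); move: h ej; clear; lia.
have := HD v; rewrite !inE vx vS => /(_ isT).
by congr (_ %| _)%Z; clear; lia.
Qed.

Lemma at_or_inside_equiv L L' : equiv_edges L L' ->
  all (at_or_inside S x) L -> all (at_or_inside S x) L'.
Proof.
move=> [G oG pG] aL; rewrite -(perm_all _ pG); elim: L G aL oG {pG} => [|e L IHL] [|d G] //=.
move=> /andP[ae aL] /andP[de oG]; rewrite (IHL G) // andbT; move: ae.
case/orP: de => /eqP-> //; rewrite /at_or_inside /crosses /inside /= addbC.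
by rewrite [X in _ || X]andbC.
Qed.

Lemma leaf_split L : cut_connected S L -> all (at_or_inside S x) L ->
  cut L [set x] = 1 -> exists a L', [/\ x != a, a \in S,
    equiv_edges L ((x, a) :: L') & cut_connected (S :\: [set x]) L'].
Proof.
move=> cL aL L1; have hx : has (crosses [set x]) L.
  by move: L1; rewrite /cut has_count; case: (count _ _).
have [a [L' [ax ev]]] := pick_cross hx; rewrite eq_sym in ax.
have cL'x : cut L' [set x] = 0.
  move: L1; rewrite -(equiv_cut _ ev) cut_cons /crosses !in_set1 eqxx eq_sym (negPf ax) /=.
  by clear; lia.
have iL' : all (inside (S :\: [set x])) L'.
  have /= /andP[_ aL'] := at_or_inside_equiv ev aL.
  apply/allP => e eL'; have /orP[ce|//] := allP aL' e eL'.
  move: cL'x; rewrite /cut => -[] /eqP; rewrite -leqn0 leqNgt -has_count.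
  by move=> /hasPn/(_ e eL'); rewrite ce.
have cL2 := connected_equiv ev cL.
exists a, L'; split=> //; last exact: connected_leaf xS iL' cL2.
by have /cut_connectedP[/= /andP[/andP[]]] := cL2.
Qed.

(** In each list of [U] the vertex [x] is a leaf: its edge goes to the star [B], and the rest of the
    list, still connected, to [F]. *)
Lemma realizable_leaves U F (B : seq (T * T)) t : (size U + size F = 2 * k - 2)%N ->
  all (cut_connected S) U -> all (all (at_or_inside S x)) U ->
  all (fun L => cut L [set x] == 1) U ->
  all (cut_connected (S :\: [set x])) F -> all (crosses [set x]) B ->
  (k - 1 <= size U + size B)%N -> consistent k S (flatten U ++ B ++ flatten F) t ->
  realizable (2 * k%:Z) S (flatten U ++ B ++ flatten F) t.
Proof.
elim: U F B => [|L U IHU] F B /=; first by rewrite add0n => *; apply: realizable_star.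
move=> sUF /andP[cL cU] /andP[aL aU] /andP[/eqP L1 LU] cF cB sB b.
have [a [L' [ax _ ev cL']]] := leaf_split cL aL L1.
have ev2 : equiv_edges ((L ++ flatten U) ++ B ++ flatten F)
    (flatten U ++ ((x, a) :: B) ++ flatten (L' :: F)).
  apply: equiv_edges_trans (equiv_cat (equiv_cat ev (equiv_edges_refl _)) (equiv_edges_refl _)) _.
  apply: perm_equiv; apply/seq.permP => p; rewrite /= !count_cat /= !count_cat /=.
  by clear; lia.
apply: (equiv_realizable ev2); apply: IHU => //=.
- by move: sUF; clear; lia.
- by rewrite cL' cF.
- by rewrite cB /crosses !in_set1 eqxx eq_sym (negPf ax).
- by move: sB; clear; lia.
- exact: consistent_equiv ev2 b.
Qed.

Definition excess U : int := \sum_(L <- U) (cut L [set x] - 1).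

Lemma excess_cons L U : excess (L :: U) = cut L [set x] - 1 + excess U.
Proof. by rewrite /excess big_cons. Qed.

Lemma excess_perm U U' : perm_eq U U' -> excess U = excess U'.
Proof. by move=> p; rewrite /excess (perm_big _ p). Qed.

(* A lift at [x] merges the only edge at [x] of one connected list with an edge at
   [x] of a list having at least two: the first list then avoids [x], the second one
   stays connected, and the excess drops by one. *)
Lemma realizable_excess n U F t : (size U + size F = 2 * k - 2)%N ->
  all (cut_connected S) U -> all (all (at_or_inside S x)) U ->
  all (fun L => 1 <= cut L [set x]) U ->
  all (cut_connected (S :\: [set x])) F ->
  excess U = n%:Z -> (k - 1 + n <= size U)%N -> consistent k S (flatten U ++ flatten F) t ->
  realizable (2 * k%:Z) S (flatten U ++ flatten F) t.
Proof.
elim: n U F => [|n IHn] U F sUF cU aU gU cF eU sU b.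
  apply: (realizable_leaves (B := [::])) => //; last by move: sU; rewrite !addn0.
  elim: U gU eU {sUF cU aU sU b} => //= L U IHU /andP[g1 gU]; rewrite excess_cons => eU.
  have : 0 <= excess U.
    elim: U gU {IHU eU} => [|L' U IHU] /=; first by rewrite /excess big_nil.
    by move=> /andP[g /IHU]; rewrite excess_cons; move: g; clear; lia.
  by move=> e0; rewrite IHU //; move: g1 eU e0; clear; lia.
(* If all lists had two edges at [x], the excess [n + 1] would be at least [size U], hence at least
   [k + n]. *)
have [L1 [U1 [/eqP L1x p1]]] : exists L1 U1, cut L1 [set x] == 1 /\ perm_eq U (L1 :: U1).
  apply: has_perm; apply: contraT => no1.
  have : (size U)%:Z <= excess U.
    elim: U no1 gU {sUF cU aU eU sU b} => [|L U IHU] /=; first by rewrite /excess big_nil.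
    rewrite negb_or excess_cons => /andP[n1 nU] /andP[g1 gU]; have := IHU nU gU.
    by move: n1 g1; clear; lia.
  by move: eU sU k_gt1; clear; lia.
have {eU} eU1 : excess U1 = n.+1%:Z.
  by move: eU; rewrite (excess_perm p1) excess_cons L1x subrr add0r.
have sU1 : size U = (size U1).+1 by rewrite (perm_size p1).
move: cU aU gU; rewrite !(perm_all _ p1) /= => /andP[cL1 cU] /andP[aL1 aU] /andP[_ gU].
have [L2 [U2 [L2x p2]]] : exists L2 U2, 1 < cut L2 [set x] /\ perm_eq U1 (L2 :: U2).
  apply: has_perm; apply: contraT => no2.
  suff : excess U1 <= 0 by move: eU1; clear; lia.
  elim: U1 no2 {p1 eU1 sU1 cU aU gU} => [|L U1 IHU] /=; first by rewrite /excess big_nil.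
  rewrite negb_or excess_cons => /andP[n1 /IHU]; move: n1; clear; lia.
have {eU1} eU2 : cut L2 [set x] - 1 + excess U2 = n.+1%:Z.
  by rewrite -excess_cons -(excess_perm p2).
have {}sU1 : size U = (size U2).+2 by rewrite sU1 (perm_size p2).
move: cU aU gU; rewrite !(perm_all _ p2) /= => /andP[cL2 cU] /andP[aL2 aU] /andP[_ gU].
have [b0 [L1' [xb bS ev1 cL1']]] := leaf_split cL1 aL1 L1x.
have hx : has (crosses [set x]) L2.
  by move: L2x; rewrite /cut has_count; case: (count _ _).
have [a1 [L3 [ax1 ev2]]] := pick_cross hx.
have hx3 : has (crosses [set x]) L3.
  move: L2x; rewrite -(equiv_cut _ ev2) cut_cons /cut has_count.
  by case: (count _ _); case: (crosses _ _).
have [a2 [L0 [ax2 ev3]]] := pick_cross hx3.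
have ev23 : equiv_edges L2 ((x, a1) :: (x, a2) :: L0).
  by apply: equiv_edges_trans ev2 _; apply: (equiv_cat (equiv_edges_refl [:: (x, a1)]) ev3).
have finish c1 c2 : c1 != x -> c2 != x -> equiv_edges L2 ((x, c1) :: (x, c2) :: L0) ->
    cut_connected S ((b0, c1) :: (x, c2) :: L0) ->
    realizable (2 * k%:Z) S (flatten U ++ flatten F) t.
  move=> c1x c2x ev cN.
  have ev4 : equiv_edges (flatten U ++ flatten F)
      ((x, b0) :: (x, c1) :: (((x, c2) :: L0) ++ flatten U2) ++ flatten (L1' :: F)).
    have q1 : equiv_edges (flatten U) (L1 ++ flatten U1) := equiv_flatten p1.
    have q2 : equiv_edges (flatten U1) (L2 ++ flatten U2) := equiv_flatten p2.
    apply: equiv_edges_trans (equiv_cat q1 (equiv_edges_refl _)) _.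
    apply: equiv_edges_trans (equiv_cat (equiv_cat ev1 q2) (equiv_edges_refl _)) _.
    apply: equiv_edges_trans (equiv_cat (equiv_cat (equiv_edges_refl _) (equiv_cat ev (equiv_edges_refl _)))
      (equiv_edges_refl _)) _.
    rewrite -[flatten (L1' :: F)]/(L1' ++ flatten F); move: (flatten U2) (flatten F) => s1 s2.
    apply: perm_equiv; apply/seq.permP => p; do 4![rewrite /= ?count_cat].
    by clear; lia.
  apply: (equiv_realizable ev4); apply: realizable_lift.
  apply: (IHn (((b0, c1) :: (x, c2) :: L0) :: U2) (L1' :: F)).
  - by move: sUF; rewrite sU1 /=; clear; lia.
  - by rewrite /= cN cU.
  - have /= /and3P[_ h2 h3] := at_or_inside_equiv ev aL2.
    have /cut_connectedP[/= /andP[/andP[/= _ c1S] _] _] := cN.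
    by rewrite /= h2 h3 aU /at_or_inside /inside !inE eq_sym xb c1x bS c1S orbT.
  - rewrite /= gU andbT; move: L2x; rewrite -(equiv_cut _ ev) !cut_cons /crosses !in_set1 /=.
    by rewrite eqxx (negPf c1x) (negPf c2x) [b0 == x]eq_sym (negPf xb) /=; clear; lia.
  - by rewrite /= cL1' cF.
  - rewrite excess_cons; move: eU2; rewrite -(equiv_cut _ ev) !cut_cons /crosses !in_set1 /=.
    by rewrite eqxx (negPf c1x) (negPf c2x) [b0 == x]eq_sym (negPf xb) /=; clear; lia.
  - by move: sU; rewrite sU1 /=; clear; lia.
  exact: consistent_lift (consistent_equiv ev4 b).
have [cN|cN] := connected_swap xS bS (connected_equiv ev23 cL2).
  exact: finish ax1 ax2 ev23 cN.
apply: finish ax2 ax1 _ cN; apply: equiv_edges_trans ev23 _; apply: perm_equiv.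
by apply/seq.permP => p /=; clear; lia.
Qed.

End Vertex.

Theorem connected_realizable S Ls t : size Ls = (2 * k - 2)%N ->
  all (cut_connected S) Ls -> consistent k S (flatten Ls) t ->
  realizable (2 * k%:Z) S (flatten Ls) t.
Proof.
have [M] := ubnP #|S|; elim: M S Ls t => // M IHM S Ls t ltM sLs cLs b.
pose nl e : bool := e.1 != e.2.
have cut_nl L A : cut (filter nl L) A = cut L A.
  elim: L => //= e L IHL; rewrite cut_cons -IHL; case: ifP; rewrite ?cut_cons //.
  by move=> /negbFE/eqP e12; rewrite /crosses e12 addbb.
(* Loops are dropped, since the lists handled at a vertex [x] must satisfy [at_or_inside]. *)
have {cLs b} [Ls' [sLs' cLs' nlLs' [b ]]] : exists Ls', [/\ size Ls' = (2 * k - 2)%N,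
    all (cut_connected S) Ls', all (all nl) Ls' & consistent k S (flatten Ls') t /\
    (realizable (2 * k%:Z) S (flatten Ls') t -> realizable (2 * k%:Z) S (flatten Ls) t)].
  exists (map (filter nl) Ls); split.
  - by rewrite size_map.
  - rewrite all_map; apply: sub_all cLs => L /cut_connectedP[iL H].
    apply/cut_connectedP; split; last by move=> A; rewrite cut_nl; apply: H.
    by rewrite all_filter; apply: sub_all iL => e /= ->; rewrite implybT.
  - by rewrite all_map; apply/allP => L _ /=; apply: filter_all.
  rewrite -filter_flatten; split.
    have [h1 h2 h3 _ _] := b; apply: consistentP => // [|v /h3]; last by rewrite cut_nl.
    by rewrite all_filter; apply: sub_all h1 => e /= ->; rewrite implybT.
  move: (flatten Ls) => E R.
  have p : perm_eq (filter (predC nl) E ++ filter nl E) E.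
    by rewrite perm_catC; apply/permPl; apply: perm_filterC.
  apply: realizable_perm p _.
  have : all (predC nl) (filter (predC nl) E) by apply: filter_all.
  elim: (filter (predC nl) E) => //= -[x y] L IHL /andP[/negbNE/eqP/= <- aL].
  by apply: realizable_loop; apply: IHL.
apply.
move: Ls' {Ls sLs} sLs' cLs' nlLs' b => Ls sLs cLs nlLs b.
apply: realizable_min => //.
- move=> A a pA A1 aA; have sA := proper_sub pA.
  have eF : map (collapse_edge A a) (flatten Ls) = flatten (map (map (collapse_edge A a)) Ls).
    by rewrite map_flatten.
  rewrite eF; apply: IHM; first last.
  + by rewrite -eF; apply: consistent_collapse.
  + rewrite all_map; apply: sub_all cLs => L /cut_connectedP[iL H].
    apply/cut_connectedP; split; first exact: inside_collapse.
    move=> B B0 pB; rewrite cut_collapse; apply: H.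
      exact: (collapse_neq0 aA (proper_sub pB) B0).
    exact: collapse_proper.
  + by rewrite size_map.
  by rewrite -ltnS; apply: leq_ltn_trans ltM; apply: card_collapse.
move=> x xS S1 ltx.
have px : [set x] \proper S by rewrite properEcard sub1set xS cards1.
have x0 : [set x] != set0 by rewrite -card_gt0 cards1.
have gLs : all (fun L => 1 <= cut L [set x]) Ls.
  by apply: sub_all cLs => L /cut_connectedP[_ H]; apply: H.
have eLs : excess x Ls = cut (flatten Ls) [set x] - (size Ls)%:Z.
  elim: Ls {sLs cLs nlLs b ltx gLs} => [|L Ls IHL] /=; first by rewrite /excess big_nil.
  by rewrite excess_cons IHL cut_cat; clear; lia.
have e0 : 0 <= excess x Ls.
  elim: Ls gLs {sLs cLs nlLs b ltx eLs} => [|L Ls IHL] /=; first by rewrite /excess big_nil.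
  by move=> /andP[g /IHL]; rewrite excess_cons; move: g; clear; lia.
have [n en] : exists n : nat, excess x Ls = n%:Z by exists `|excess x Ls|%N; move: e0; clear; lia.
have IHx Ls' t' : size Ls' = (2 * k - 2)%N ->
    all (cut_connected (S :\: [set x])) Ls' -> consistent k (S :\: [set x]) (flatten Ls') t' ->
    realizable (2 * k%:Z) (S :\: [set x]) (flatten Ls') t'.
  by apply: IHM; rewrite -ltnS; apply: leq_ltn_trans ltM; rewrite (cardsD1 x S) xS.
rewrite -[flatten Ls]cats0; apply: (realizable_excess xS IHx (n := n) (F := [::])) => //=.
- by rewrite addn0.
- apply/allP => L LL; apply/allP => e eL.
  have /cut_connectedP[iL _] := allP cLs L LL.
  have /andP[e1 e2] := allP iL e eL; have := allP (allP nlLs L LL) e eL.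
  rewrite /nl /at_or_inside /crosses /inside !inE e1 e2 !andbT.
  have [e1x|n1] := eqVneq e.1 x; have [e2x|n2] := eqVneq e.2 x => //=.
  by rewrite e1x e2x eqxx.
(* Violating the cut condition means degree at most [3k - 3], that is [n <= k - 1]. *)
- have := dist2_lek k_gt0 (t x); move: en eLs ltx; rewrite sLs; move: k_gt1; clear; lia.
by rewrite cats0.
Qed.

End Trees.

(** * Equitable colourings *)

Lemma orients_fun (T : finType) (Y : eqType) (g : Y -> T * T) (s : seq Y) D :
  uniq s -> orients D (map g s) ->
  exists2 f : Y -> T * T, D = map f s & {in s, forall y, same_ends (f y) (g y)}.
Proof.
elim: s D => [|y s IH] [|d D] //=; first by exists g.
move=> /andP[ys us] /andP[dy /(IH D us)[f -> Hf]].
exists (fun z => if z == y then d else f z) => [|z].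
  rewrite eqxx; congr cons; apply/eq_in_map => z zs.
  by case: eqP => // zy; rewrite -zy zs in ys.
by rewrite inE; case: eqP => [->//|_ /= /Hf].
Qed.

(** Lifting two edges at a vertex preserves net degrees, so one may assume that every vertex has at
    most one edge besides loops. Modulus [0] turns the congruences into equalities. *)
Lemma balanced_orientation (T : finType) (E : seq (T * T)) :
  exists2 t : T -> int, forall v, `|t v| <= 1 & realizable 0 [set: T] E t.
Proof.
have [n] := ubnP (size E); elim: n E => // n IH E ltn.
have [/existsP[x cx]|] := boolP [exists x, 1 < cut E [set x]].
  have hx : has (crosses [set x]) E.
    by move: cx; rewrite /cut has_count; case: (count _ _).
  have [a [E1 [ax ev1]]] := pick_cross hx.
  have hx1 : has (crosses [set x]) E1.
    move: cx; rewrite -(equiv_cut _ ev1) cut_cons /cut has_count.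
    by case: (count _ _); case: (crosses _ _).
  have [b [E2 [bx ev2]]] := pick_cross hx1.
  have ev : equiv_edges E ((x, a) :: (x, b) :: E2).
    by apply: equiv_edges_trans ev1 _; apply: (equiv_cat (equiv_edges_refl [:: (x, a)]) ev2).
  have [|t ht Ht] := IH ((a, b) :: E2).
    by move: ltn; rewrite -(equiv_size ev) /=.
  by exists t => //; apply: equiv_realizable ev _; apply: realizable_lift.
rewrite negb_exists => /forallP hc.
exists (fun v => net E [set v]) => [v|].
  have [h _] := net_orients [set v] (orients_refl E); apply: le_trans h _.
  by have := hc v; rewrite -leNgt.
by exists E; [apply: orients_refl | move=> v _; rewrite subrr].
Qed.

Definition sgn (b : bool) : int := if b then 1 else -1.

Section Signs.
Variables (V Y : finType) (l r : Y -> V) (s : pred Y).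
Hypothesis slr : forall y, s y -> l y = r y.

(** Two elements of [s] at the same vertex have both ends in common; opposite signs make them vanish
    from all three sums, so they can be removed. With at most one left at each vertex, the third
    bound is automatic. *)
Lemma balanced_signs (h : seq Y) : uniq h -> exists g : Y -> bool, forall v,
  [/\ `|\sum_(y <- h | l y == v) sgn (g y)| <= 1,
      `|\sum_(y <- h | r y == v) sgn (g y)| <= 1 &
      `|\sum_(y <- h | s y && (l y == v)) sgn (g y)| <= 1].
Proof.
have [n] := ubnP (size h); elim: n h => // n IH h ltn uh.
have [|nodup] := boolP (has (fun y => s y &&
    has (fun z => [&& z != y, s z & l z == l y]) h) h).
  move=> /has_perm[y [h1 [/andP[sy hz] p1]]].
  have {hz} : has (fun z => [&& z != y, s z & l z == l y]) h1.
    by move: hz; rewrite (perm_has _ p1) /= eqxx.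
  move=> /has_perm[z [h2 [/and3P[zy sz /eqP lzy] p2]]].
  have p : perm_eq h (y :: z :: h2) by apply: perm_trans p1 _; rewrite perm_cons.
  have := perm_uniq p; rewrite uh /= => /esym/and3P[yh zh uh2].
  have [|g Hg] := IH h2 _ uh2; first by move: ltn; rewrite (perm_size p) /=; clear; lia.
  exists (fun w => if w == y then true else if w == z then false else g w) => v.
  have [H1 H2 H3] := Hg v.
  have main (P : pred Y) : P y = P z ->
      \sum_(w <- h | P w) sgn (if w == y then true else if w == z then false else g w) =
      \sum_(w <- h2 | P w) sgn (g w).
    move=> Pyz; rewrite (perm_big _ p) !big_cons /= Pyz eqxx (negPf zy) eqxx.
    have -> : \sum_(w <- h2 | P w) sgn (if w == y then true else if w == z then false else g w) =
        \sum_(w <- h2 | P w) sgn (g w).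
      rewrite big_seq_cond [RHS]big_seq_cond; apply: eq_bigr => w /andP[wh _].
      case: eqP => [wy|_]; first by move: yh; rewrite -wy inE wh orbT.
      by case: eqP => // wz; move: zh; rewrite -wz wh.
    by case: (P z) => //=; rewrite addrA /sgn subrr add0r.
  by rewrite !main // ?slr // -?slr // ?lzy // sy sz.
(* The sign tells whether the edge runs from its left to its right end; the net degree is the signed
   sum at a left copy and its opposite at a right copy. *)
pose e y : (V + V) * (V + V) := (inl (l y), inr (r y)).
have [t ht [D oD HD]] := balanced_orientation (map e h).
have [f eD Hf] := orients_fun uh oD.
have net_t v : net D [set v] = t v.
  by have := HD v (in_setT _); rewrite dvd0z subr_eq0 => /eqP.
exists (fun y => f y == e y) => v; split.
- have := ht (inl v); rewrite -net_t eD /net big_map.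
  congr (`| _ | <= _); rewrite [RHS]big_mkcond big_seq [RHS]big_seq /=.
  apply: eq_bigr => y /Hf /orP[]/eqP->; rewrite !in_set1 /= ?eqxx /sgn;
    by rewrite -[inl _ == _]/(l y == v); case: (l y == v).
- have := ht (inr v); rewrite -net_t eD /net big_map -normrN -sumrN.
  congr (`| _ | <= _); rewrite [RHS]big_mkcond big_seq [RHS]big_seq /=.
  apply: eq_bigr => y /Hf /orP[]/eqP->; rewrite !in_set1 /= ?eqxx /sgn;
    by rewrite -[inr _ == _]/(r y == v); case: (r y == v).
set P := (fun y => s y && (l y == v)).
have [/has_perm[y [h1 [Py p1]]]|] := boolP (has P h); last first.
  move=> /hasPn nP; rewrite big_seq_cond big1 ?normr0 // => y /andP[/nP/negPf ny].
  by rewrite -/(P y) ny.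
rewrite (perm_big _ p1) big_cons -[s y && _]/(P y) Py big_seq_cond big1 => [|z /andP[zh1 Pz]].
  by rewrite /= addr0 /sgn; case: ifP.
have /andP[sy /eqP ly] := Py; have /andP[sz /eqP lz] := Pz.
case/negP: nodup; apply/hasP; exists y; first by rewrite (perm_mem p1) mem_head.
rewrite sy /=; apply/hasP; exists z; first by rewrite (perm_mem p1) inE zh1 orbT.
rewrite sz lz ly eqxx !andbT; apply: contraTneq zh1 => ->.
by have := perm_uniq p1; rewrite uh /= => /esym/andP[].
Qed.

End Signs.

Lemma balanced_squares (a b p q : nat) : (a + b = p + q)%N -> `|a%:Z - b%:Z| <= 1 ->
  (a ^ 2 + b ^ 2 <= p ^ 2 + q ^ 2)%N /\
  ((q.+1 < p)%N -> (a ^ 2 + b ^ 2 < p ^ 2 + q ^ 2)%N).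
Proof.
wlog qp : p q / (q <= p)%N.
  have [le|lt] := leqP q p => H; first exact: H.
  move=> e ab; have [h1 _] := H q p (ltnW lt) (etrans e (addnC _ _)) ab.
  by split; [rewrite [(p ^ 2 + _)%N]addnC | move: lt; clear; lia].
wlog ab : a b / (b <= a)%N.
  have [le|lt] := leqP b a => H; first exact: H.
  move=> e h; rewrite [(a ^ 2 + _)%N]addnC; apply: H; first exact: ltnW.
    by rewrite addnC.
  by rewrite distrC.
move=> e h; have bd : (q <= b)%N by move: e h qp ab; clear; lia.
have [d eb] : exists d, b = (q + d)%N by exists (b - q)%N; rewrite subnKC.
have ep : (p = a + d)%N by move: e; rewrite eb; clear; lia.
by move: h ab; rewrite eb ep !expnS !expn0 !muln1; clear => h ab; split; nia.
Qed.

Section Equitable.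
Variables (Y J : finType) (inc : J -> pred Y) (k : nat).

Definition colour_count (c : {ffun Y -> 'I_k}) j i : nat :=
  #|[set y | inc j y && (c y == i)]|.

Let energy (c : {ffun Y -> 'I_k}) : nat := \sum_j \sum_i (colour_count c j i) ^ 2.

(* A colouring minimizing the sum of squares of all counts is equitable, since two
   colours could otherwise be redistributed according to balanced signs. *)
Lemma equitable_colouring : (0 < k)%N ->
  (forall H : {set Y}, exists g : Y -> bool, forall j,
     `|\sum_(y in H | inc j y) sgn (g y)| <= 1) ->
  exists c : {ffun Y -> 'I_k}, forall j i i',
    (colour_count c j i <= (colour_count c j i').+1)%N.
Proof.
move=> k0 signs; pose c0 : {ffun Y -> 'I_k} := [ffun=> Ordinal k0].
case: (arg_minnP energy (isT : predT c0)) => c _ minc; exists c => j0 i i'.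
rewrite leqNgt; apply/negP => gt.
have ii : i != i' by apply: contraTneq gt => ->; rewrite -leqNgt leqW.
have ii' : i' != i by rewrite eq_sym.
have [g Hg] := signs [set y | (c y == i) || (c y == i')].
pose c' : {ffun Y -> 'I_k} :=
  [ffun y => if (c y == i) || (c y == i') then (if g y then i else i') else c y].
have same j m : m != i -> m != i' -> colour_count c' j m = colour_count c j m.
  move=> mi mi'; congr #|pred_of_set _|; apply/setP => y; rewrite !inE ffunE; congr (_ && _).
  have [->|n1] /= := eqVneq (c y) i; last have [->|n2] := eqVneq (c y) i' => //=;
    by case: (g y); rewrite ![_ == m]eq_sym ?(negPf mi) ?(negPf mi').
have cntE (d : {ffun Y -> 'I_k}) j m : (colour_count d j m)%:Z = \sum_(y | inc j y) (d y == m)%:Z.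
  rewrite [RHS](eq_bigr (fun y => if d y == m then 1 else 0)) => [|y _]; last by case: ifP.
  by rewrite -big_mkcondr sumr_const natz /colour_count cardsE.
have tot j : (colour_count c' j i + colour_count c' j i' =
    colour_count c j i + colour_count c j i')%N.
  apply/eqP; rewrite -eqz_nat !PoszD !cntE -!big_split /=; apply/eqP.
  apply: eq_bigr => y _; rewrite ffunE.
  have [e1|n1] /= := eqVneq (c y) i; last have [e2|n2] /= := eqVneq (c y) i'.
  - by rewrite ?e1; case: (g y); rewrite ?eqxx ?(negPf ii) ?(negPf ii').
  - by case: (g y); rewrite ?eqxx ?(negPf ii) ?(negPf ii').
  - by rewrite (negPf n1) (negPf n2).
have diff j : `|(colour_count c' j i)%:Z - (colour_count c' j i')%:Z| <= 1.
  have := Hg j; congr (`| _ | <= _); rewrite !cntE -sumrB.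
  rewrite big_mkcondl /=; apply: eq_bigr => y _; rewrite inE ffunE.
  case: ifP => [_|/norP[/negPf-> /negPf->]] //=.
  by case: (g y); rewrite /sgn ?eqxx ?(negPf ii) ?(negPf ii') ?subr0 ?sub0r.
have energyD d j : (\sum_m (colour_count d j m) ^ 2 = colour_count d j i ^ 2 +
    (colour_count d j i' ^ 2 + \sum_(m | (m != i) && (m != i')) (colour_count d j m) ^ 2))%N.
  by rewrite (bigD1 i) //= (bigD1 i') /= 1?eq_sym.
have rest j : (\sum_(m | (m != i) && (m != i')) (colour_count c' j m) ^ 2 =
    \sum_(m | (m != i) && (m != i')) (colour_count c j m) ^ 2)%N.
  by apply: eq_bigr => m /andP[mi mi']; rewrite same.
have le1 j : (\sum_m (colour_count c' j m) ^ 2 <= \sum_m (colour_count c j m) ^ 2)%N.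
  rewrite !energyD rest !addnA leq_add2r; have := tot j; have := diff j.
  move: (colour_count c' j i) (colour_count c' j i') (colour_count c j i) (colour_count c j i').
  by clear => a b p q h1 h2; case: (balanced_squares h2 h1).
have lt1 : (\sum_m (colour_count c' j0 m) ^ 2 < \sum_m (colour_count c j0 m) ^ 2)%N.
  rewrite !energyD rest !addnA ltn_add2r; have := tot j0; have := diff j0; move: gt.
  move: (colour_count c' j0 i) (colour_count c' j0 i') (colour_count c j0 i) (colour_count c j0 i').
  by clear => a b p q gt h1 h2; case: (balanced_squares h2 h1) => _; apply.
have := minc c' isT; rewrite leqNgt => /negP; apply.
rewrite /energy (bigD1 j0) //= [X in (_ < X)%N](bigD1 j0) //= -addSn.
by apply: leq_add => //; apply: leq_sum => j _.
Qed.

End Equitable.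

Lemma equitable_const k (f : 'I_k -> nat) a : (forall i i', f i <= (f i').+1)%N ->
  (\sum_i f i = k * a)%N -> forall i, f i = a.
Proof.
move=> H sf i; have sa : (\sum_(i < k) a = k * a)%N by rewrite sum_nat_const card_ord.
move: sf; rewrite -sa (bigD1 i) //= [RHS](bigD1 i) //= => e.
have [lt|gt|//] := ltngtP (f i) a.
  suff : (f i + \sum_(j | j != i) f j < a + \sum_(j < k | j != i) a)%N by rewrite e ltnn.
  by rewrite -addSn leq_add // leq_sum // => j _; apply: leq_trans (H j i) lt.
suff : (a + \sum_(j < k | j != i) a < f i + \sum_(j | j != i) f j)%N by rewrite e ltnn.
rewrite -addSn leq_add // leq_sum // => j _.
by rewrite -ltnS; apply: leq_trans gt (H i j).
Qed.

Lemma equitable_le1 k (f : 'I_k -> nat) p : (forall i i', f i <= (f i').+1)%N ->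
  (\sum_i f i = p)%N -> (p < k)%N -> forall i, (f i <= 1)%N /\ (f i <= p)%N.
Proof.
move=> H <- ltk i; split; last by rewrite (bigD1 i) //= leq_addr.
rewrite leqNgt; apply/negP => gt; move: ltk; rewrite ltnNge => /negP; apply.
rewrite -[leqLHS]card_ord -sum1_card; apply: leq_sum => j _.
by rewrite -ltnS; apply: leq_trans gt (H i j).
Qed.

Section Factorization.
Variables (V X : finType) (k : nat) (tl hd : X -> V).
Hypothesis k_gt0 : (0 < k)%N.

Let outd v := #|[set x | tl x == v]|.
Let ind v := #|[set x | hd x == v]|.
Let pad v := ((k - outd v %% k) %% k)%N.

(** The varying number [pad v < k] of dummies is cut out of [k] candidates at each [v]; inactive
    candidates are incident with nothing. *)
Let active (y : X + V * 'I_k) := if y is inr p then (p.2 < pad p.1)%N else true.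
Let lft (y : X + V * 'I_k) := match y with inl x => tl x | inr p => p.1 end.
Let rgt (y : X + V * 'I_k) := match y with inl x => hd x | inr p => p.1 end.
Let dummy (y : X + V * 'I_k) := if y is inr _ then true else false.
Let inc (j : V + V + V) (y : X + V * 'I_k) := active y &&
  match j with
  | inl (inl v) => lft y == v
  | inl (inr v) => rgt y == v
  | inr v => dummy y && (lft y == v)
  end.

Let card_sumset (Y Z : finType) (P : pred (Y + Z)) :
  #|[set y | P y]| = (#|[set y | P (inl y)]| + #|[set z | P (inr z)]|)%N.
Proof. by rewrite -!sum1dep_card big_sumType. Qed.

(* [pad v] dummy arcs from the out-copy of [v] to its in-copy make both copies have
   degree divisible by [k]; colouring the dummies equitably as well makes a colour
   round the out-degree and the in-degree in the same way. *)
Lemma equitable_factorization : (forall v, outd v = ind v %[mod k]) ->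
  exists c : X -> 'I_k, forall i v, exists A d p : nat,
    [/\ (#|[set x | (c x == i) && (tl x == v)]| +
         #|[set x | (c x == i) && (hd x == v)]| + 2 * d = A)%N,
        (A * k = outd v + ind v + 2 * p)%N,
        (d <= 1)%N, (d <= p)%N & (p < k)%N].
Proof.
move=> modk; have padk v : (pad v < k)%N by rewrite ltn_mod.
have [H|c Hc] := @equitable_colouring _ _ inc k k_gt0.
  pose h := [seq y <- enum H | active y].
  have uh : uniq h by rewrite filter_uniq ?enum_uniq.
  have slr y : dummy y -> lft y = rgt y by case: y.
  have [g Hg] := balanced_signs slr uh; exists g => j.
  have sumE (P : pred (X + V * 'I_k)) :
      \sum_(y in H | active y && P y) sgn (g y) = \sum_(y <- h | P y) sgn (g y).
    by rewrite big_filter_cond big_enum_cond; apply: eq_bigl.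
  by case: j => [[v|v]|v]; rewrite sumE; have [] := Hg v.
have tot j : (\sum_i colour_count inc c j i = #|[set y | inc j y]|)%N.
  rewrite -sum1dep_card (partition_big c predT) //=; apply: eq_bigr => i _.
  by rewrite /colour_count -sum1dep_card.
have dum v : #|[set p : V * 'I_k | (p.2 < pad p.1)%N && (p.1 == v)]| = pad v.
  rewrite -sum1dep_card (eq_bigl (fun p : V * 'I_k => (p.1 == v) && (p.2 < pad v)%N)); last first.
    by move=> [u m] /=; rewrite andbC; case: eqP => //= ->.
  rewrite -(pair_big_dep (fun u => u == v) (fun u (m : 'I_k) => (m < pad v)%N) (fun _ _ => 1%N)) /=.
  by rewrite big_pred1_eq -(big_ord_widen k (fun=> 1%N) (ltnW (padk v))) sum1_card card_ord.
have totl v : #|[set y | inc (inl (inl v)) y]| = (outd v + pad v)%N.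
  by rewrite card_sumset -[in RHS](dum v).
have totr v : #|[set y | inc (inl (inr v)) y]| = (ind v + pad v)%N.
  by rewrite card_sumset -[in RHS](dum v).
have totd v : #|[set y | inc (inr v) y]| = pad v.
  by rewrite card_sumset -[in RHS](dum v) [X in (X + _)%N]eq_card0 // => x; rewrite inE.
have dvo v : (k %| outd v + pad v)%N.
  rewrite /dvdn modnDmr -modnDml subnKC ?modnn //; apply: ltnW; exact: ltn_pmod.
have dvi v : (k %| ind v + pad v)%N.
  by have := dvo v; rewrite /dvdn -modnDml modk modnDml.
exists (fun x => c (inl x)) => i v.
pose d := #|[set p : V * 'I_k | [&& (p.2 < pad p.1)%N, p.1 == v & c (inr p) == i]]|.
have cl : colour_count inc c (inl (inl v)) i = (#|[set x | (c (inl x) == i) && (tl x == v)]| + d)%N.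
  rewrite /colour_count card_sumset; congr (_ + _)%N; apply: eq_card => x; rewrite !inE.
    by rewrite andbC.
  by rewrite /inc /= andbA.
have cr : colour_count inc c (inl (inr v)) i = (#|[set x | (c (inl x) == i) && (hd x == v)]| + d)%N.
  rewrite /colour_count card_sumset; congr (_ + _)%N; apply: eq_card => x; rewrite !inE.
    by rewrite andbC.
  by rewrite /inc /= andbA.
have cd : colour_count inc c (inr v) i = d.
  rewrite /colour_count card_sumset [X in (X + _)%N]eq_card0 => [|x]; last by rewrite inE.
  by apply: eq_card => p; rewrite !inE /inc /= andbA.
have /dvdnP[a ea] := dvo v; have /dvdnP[b eb] := dvi v.
have h1 := equitable_const (Hc _) (etrans (tot _) (etrans (totl v) (etrans ea (mulnC _ _)))) i.
have h2 := equitable_const (Hc _) (etrans (tot _) (etrans (totr v) (etrans eb (mulnC _ _)))) i.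
have [h3 h4] := equitable_le1 (Hc _) (etrans (tot _) (totd v)) (padk v) i.
rewrite cl in h1; rewrite cr in h2; rewrite cd in h3 h4.
exists (a + b)%N, d, (pad v); split=> //; first by move: h1 h2; clear; lia.
by rewrite mulnDl; move: ea eb; clear; lia.
Qed.

End Factorization.

(** * Multigraphs *)

Section Graph.
Variable G : mgraph.
Implicit Types (A : {set vert G}) (F : {set edge G}).

Definition end_list (s : seq (edge G)) : seq (vert G * vert G) := map (@ends G) s.

Lemma cut_end_list F A :
  cut (end_list (enum F)) A = #|[set e in F | ((ends e).1 \in A) (+) ((ends e).2 \in A)]|%:Z.
Proof.
by rewrite /cut count_map -sum1_count big_enum_cond sum1dep_card.
Qed.

Lemma deg_factor F v : deg (G := factor F) v =
  (#|[set e in F | (ends e).1 == v]| + #|[set e in F | (ends e).2 == v]|)%N.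
Proof.
have H (P : pred (edge G)) :
    #|[set e : {e : edge G | e \in F} | P (val e)]| = #|[set e in F | P e]|.
  rewrite -(card_imset _ val_inj); apply: eq_card => e; rewrite inE.
  apply/imsetP/andP => [[e' Pe' ->]|[eF Pe]].
    by rewrite inE in Pe'; split=> //; apply: valP e'.
  by exists (exist _ e eF); rewrite ?inE.
by rewrite /deg /= (H (fun e => (ends e).1 == v)) (H (fun e => (ends e).2 == v)).
Qed.

Lemma tree_cut_connected F : connected_graph (factor F) ->
  cut_connected setT (end_list (enum F)).
Proof.
move=> con; apply/cut_connectedP; split.
  by apply/allP => e _; rewrite /inside !inE.
move=> A /set0Pn[x xA] /properP[_ [y _ yA]].
rewrite cut_end_list ltz_nat card_gt0; apply: contraNneq yA => noe.
have cl : closed (@adjacent (factor F)) (mem A).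
  move=> u v /existsP[e]; have := in_set0 (val e); rewrite -noe inE (valP e) /=.
  by rewrite /joins /= => + /orP[] /eqP e12; rewrite e12 /= => /negbT;
    rewrite negb_add => /eqP.
by rewrite -(closed_connect cl (con x y)).
Qed.

Lemma perm_enum_disjoint m (T : 'I_m -> {set edge G}) : edge_disjoint T ->
  perm_eq (enum [set: edge G]) (flatten (map (fun i => enum (T i)) (enum 'I_m)) ++
    enum (~: \bigcup_i T i)).
Proof.
move=> dT; apply: uniq_perm; first exact: enum_uniq.
  rewrite cat_uniq enum_uniq andbT; apply/andP; split; last first.
    apply/hasPn => e; rewrite mem_enum inE; apply: contra => /flatten_mapP[i _].
    by rewrite mem_enum => eT; apply/bigcupP; exists i.
  elim: (enum 'I_m) (enum_uniq 'I_m) => //= i s IHs /andP[is_ us].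
  rewrite cat_uniq enum_uniq IHs // andbT; apply/hasPn => e /flatten_mapP[j js].
  rewrite !mem_enum; have ij : i != j by apply: contraNneq is_ => ->.
  by have /disjointFl eT := dT i j ij => /eT ->.
move=> e; rewrite mem_cat !mem_enum !inE; apply/esym.
have [/bigcupP[i _ ei]|] := boolP (e \in \bigcup_i T i); last by rewrite orbT.
by rewrite orbF; apply/flatten_mapP; exists i; rewrite mem_enum.
Qed.

Lemma modular_orientation k : odd k ->
  odd_edge_connected (3 * k - 2) G \/ tree_connected (2 * k - 2) G ->
  exists2 D, orients D (end_list (enum [set: edge G])) & forall v, (k%:Z %| net D [set v])%Z.
Proof.
move=> oddk con; have [k1|k1] := leqP k 1.
  have -> : k = 1%N by move: k1 oddk; clear; case: k => [|[]].
  by exists (end_list (enum [set: edge G])); [exact: orients_refl | move=> v; rewrite dvd1z].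
(* The multiple of [k] modulo [2k] that has the parity of the degree, [k] being odd. *)
set E := end_list _; pose t v : int := if (2 %| cut E [set v])%Z then 0 else k%:Z.
have kt v : (k%:Z %| t v)%Z by rewrite /t; case: ifP.
have b : consistent k setT E t.
  have iE : all (inside setT) E by apply/allP => e _; rewrite /inside !inE.
  have par v : (2 %| t v - cut E [set v])%Z.
    rewrite /t; case: ifP => [|/negbT]; first by rewrite sub0r rpredN.
    by move: oddk; clear; lia.
  apply: consistentP => //.
  have ck : coprimez 2 k%:Z by rewrite coprimezE coprime2n.
  rewrite Gauss_dvdz // [X in _ && X]rpred_sum ?andbT => [|v _]; last exact: kt.
  have := vsum_cut_par E setT; have := @vsum_par _ setT t _ (fun v _ => par v).
  by rewrite (cut_S iE); clear; lia.
suff [D oD HD] : realizable (2 * k%:Z) setT E t.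
  exists D => // v; have := HD v (in_setT v) => h.
  rewrite -(subrK (t v) (net D _)) rpredD //.
  by apply: dvdz_trans h; apply: dvdz_mull.
case: con => [oc|[T [dT trT]]].
  apply: odd_cuts_realizable => // A _; rewrite cut_end_list.
  rewrite (_ : #|_| = cut_size A); last by apply: eq_card => e; rewrite !inE.
  move=> o; have := oc A; have -> : odd (cut_size A) by move: o; clear; lia.
  by move=> /(_ isT); move: k1; clear; lia.
pose Ls := map (fun i => end_list (enum (T i))) (enum 'I_(2 * k - 2)).
(* Edges outside the trees keep their given direction, and [t] is corrected by their net degrees. *)
pose R := end_list (enum (~: \bigcup_i T i)).
have p : perm_eq E (flatten Ls ++ R).
  rewrite (perm_trans (perm_map _ (perm_enum_disjoint dT))) // map_cat map_flatten -map_comp.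
  exact: perm_refl.
apply: (equiv_realizable (perm_equiv p)).
have b1 := consistent_equiv (perm_equiv p) b.
have iR : all (inside setT) R by apply/allP => e _; rewrite /inside !inE.
have [|||D oD HD] := @connected_realizable _ k k1 setT Ls (fun v => t v - net R [set v]).
- by rewrite size_map size_enum_ord.
- by rewrite all_map; apply/allP => i _; apply: tree_cut_connected; have [] := trT i.
- have [h1 h2 h3 _ _] := b1; apply: consistentP.
  + by move: h1; rewrite all_cat => /andP[].
  + by rewrite vsumB -net_sum net_S // subr0.
  + move=> v /h3; rewrite cut_cat; have [_] := net_orients [set v] (orients_refl R).
    by clear; lia.
exists (D ++ R); first by apply: orients_cat => //; apply: orients_refl.
move=> v /HD; rewrite net_cat; congr (_ %| _)%Z; clear; lia.
Qed.

End Graph.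

Local Close Scope ring_scope.

Theorem theorem4p2 (k : nat) (G : mgraph) :
  0 < k -> odd k ->
  odd_edge_connected (3 * k - 2) G \/ tree_connected (2 * k - 2) G ->
  exists F : 'I_k -> {set edge G},
    edge_decomposition F /\
    forall (i : 'I_k) (v : vert G),
      deg (G := factor (F i)) v = deg v %[mod 2] /\
      (`| (deg (G := factor (F i)) v)%:R - (deg v)%:R / k%:R | < 2 :> rat)%R.
Proof.
move=> k0 oddk /(modular_orientation oddk)[D oD HD].
have [f eD Hf] := orients_fun (enum_uniq _) oD.
have {}Hf e : same_ends (f e) (ends e) by apply: Hf; rewrite mem_enum in_setT.
have cardE (P Q : pred (edge G)) : (#|[set e | P e && Q e]| = \sum_(e | P e) Q e)%N.
  by rewrite -sum1dep_card big_mkcondr /=; apply: eq_bigr => e _; case: (Q e).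
have both (P : pred (edge G)) v :
    (#|[set e | P e && ((ends e).1 == v)]| + #|[set e | P e && ((ends e).2 == v)]| =
     #|[set e | P e && ((f e).1 == v)]| + #|[set e | P e && ((f e).2 == v)]|)%N.
  rewrite !cardE -!big_split /=; apply: eq_bigr => e _.
  by case/orP: (Hf e) => /eqP-> //=; rewrite addnC.
have bothT v : deg v = (#|[set e | (f e).1 == v]| + #|[set e | (f e).2 == v]|)%N.
  exact: both predT v.
have modk v : #|[set e | (f e).1 == v]| = #|[set e | (f e).2 == v]| %[mod k].
  apply/eqP; rewrite -eqz_nat -!modz_nat eqz_mod_dvd.
  move: (HD v); congr (_ %| _)%Z; rewrite eD /net big_map.
  rewrite (cardE predT (fun e => (f e).1 == v)) (cardE predT (fun e => (f e).2 == v)).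
  rewrite sumrB; congr (_ - _)%R; rewrite big_enum /= (big_morph Posz PoszD (erefl _)) /=;
    by apply: eq_big => e; rewrite ?in_setT ?in_set1.
have [c Hc] := equitable_factorization k0 modk.
exists (fun i => [set e | c e == i]); split.
  split; last by apply/setP => e; rewrite in_setT; apply/bigcupP; exists (c e); rewrite ?inE.
  move=> i j ij; rewrite -setI_eq0; apply/eqP/setP => e; rewrite !inE.
  by case: eqP => //= ->; apply/negbTE.
move=> i v; have [A [d [p [e1 e2 d1 dp pk]]]] := Hc i v.
have degF : (deg (G := factor [set e | c e == i]) v + 2 * d = A)%N.
  rewrite deg_factor -e1 -both; congr (_ + _ + _)%N; apply: eq_card => e; rewrite !inE //.
have {}e2 : (A * k = deg v + 2 * p)%N by rewrite bothT.
move: (deg _) degF (deg v) e2 => x degF y e2; split.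
  apply/eqP; rewrite !modn2; have := congr1 odd e2; rewrite -degF.
  by rewrite !mul2n ssrnat.oddM !oddD !odd_double oddk !addbF andbT => ->.
have K0 : (0 < k%:R :> rat)%R by rewrite ltr0n.
have eq1 : (x%:R - y%:R / k%:R = (2 * p%:R - 2 * d%:R * k%:R) / k%:R :> rat)%R.
  have : ((x%:R + 2 * d%:R) * k%:R = y%:R + 2 * p%:R :> rat)%R.
    by rewrite -!natrM -!natrD -natrM degF e2.
  move=> h; have -> : (y%:R = (x%:R + 2 * d%:R) * k%:R - 2 * p%:R :> rat)%R by rewrite h addrK.
  by field; rewrite gt_eqF.
rewrite eq1 normrM normfV (gtr0_norm K0) ltr_pdivrMr //.
have p0 : (0 <= p%:R :> rat)%R by rewrite ler0n.
have pk' : (p%:R < k%:R :> rat)%R by rewrite ltr_nat.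
(* The difference is [2p/k] for [d = 0] and [2p/k - 2] for [d = 1]. In the latter case [d <= p]
   makes [p] positive, so the value [-2] is not reached. *)
case: d d1 dp {e1 degF eq1} => [|[|//]] _ dp.
  by rewrite mulr0 mul0r subr0 ger0_norm; lra.
have p1 : (1 <= p%:R :> rat)%R by rewrite ler1n.
by rewrite ltr_norml; apply/andP; split; lra.
Qed.
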